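(* Let $\{\Phi_t\}_{t\geq0}$ be a continuous semigroup of analytic functions in the class $\mathcal{G}_{\infty}$, and let $c_t=c_{\Phi_t}$ be the characteristic of $\Phi_t$. Then $c_t=1$ for every $t\ge0$.
   Context: $\mathbb{C}_\theta=\{s\in\mathbb{C}:\operatorname{Re}(s)>\theta\}$ and $\mathbb{C}_+=\mathbb{C}_0$. $\mathcal{D}$ denotes the space of Dirichlet series $\sum_{n\ge1}a_nn^{-s}$ that converge in some half-plane $\mathbb{C}_\theta$; a holomorphic function on a half-plane belongs to $\mathcal{D}$ if it coincides with such a convergent series on some half-plane. Class $\mathcal{G}_\infty$: an analytic $\Phi:\mathbb{C}_+\to\mathbb{C}_+$ belongs to $\mathcal{G}_\infty$ if there are $c_\Phi\in\mathbb{N}\cup\{0\}$ and $\varphi\in\mathcal{D}$ such that $\Phi(s)=c_\Phi s+\varphi(s)$ for $s\in\mathbb{C}_+$. The value $c_\Phi$ is called the characteristic of $\Phi$. A continuous semigroup is a family $\{\Phi_t\}_{t\ge0}$ of analytic functions $\Phi_t:\mathbb{C}_+\to\mathbb{C}_+$ with $\Phi_0(s)=s$, $\Phi_t\circ\Phi_u=\Phi_{t+u}$ for all $t,u\ge0$, and $\Phi_t\to\Phi_0$ uniformly on compact subsets of $\mathbb{C}_+$ as $t\to0^+$. *)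

(* Defs.v *)
From HB Require Import structures.
From mathcomp Require Import all_boot all_order all_algebra.
From mathcomp Require Import all_classical all_reals all_analysis.
From mathcomp Require Import complex.
Set Implicit Arguments.
Unset Strict Implicit.
Unset Printing Implicit Defensive.
Import Order.TTheory GRing.Theory Num.Theory.
Import numFieldNormedType.Exports.
Local Open Scope classical_set_scope.
Local Open Scope ring_scope.
Local Open Scope complex_scope.

(* The [^o] gives the complex numbers their canonical structure of normed space
   over themselves, so that [derivable] is complex differentiability. *)
Notation Cplx R := (R[i]^o).

Definition half_plane (R : realType) (theta : R) : set (Cplx R) :=
  [set s | theta < complex.Re s].

Definition holomorphic_on (R : realType) (U : set (Cplx R))
    (f : Cplx R -> Cplx R) : Prop :=
  forall s, U s -> derivable f s 1.

Definition cexp (R : realType) (z : Cplx R) : Cplx R :=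
  (expR (complex.Re z) * cos (complex.Im z)) +i* (expR (complex.Re z) * sin (complex.Im z)).

Definition nat_cpow (R : realType) (n : nat) (s : Cplx R) : Cplx R :=
  cexp ((ln n%:R)%:C * s).

(* The coefficient [a 0] is not used. *)
Definition dirichlet_term (R : realType) (a : nat -> Cplx R) (s : Cplx R)
    (k : nat) : Cplx R :=
  a k.+1 * nat_cpow k.+1 (- s).

Definition dirichlet_sum (R : realType) (a : nat -> Cplx R)
    (s l : Cplx R) : Prop :=
  series (dirichlet_term a s) @ \oo --> l.

(* Functions on the half-plane of abscissa [theta0] are represented by total
   functions whose values elsewhere are irrelevant; hence [theta0 <= theta]. *)
Definition dirichlet_class (R : realType) (theta0 : R)
    (phi : Cplx R -> Cplx R) : Prop :=
  holomorphic_on (half_plane theta0) phi /\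
  exists (a : nat -> Cplx R) (theta : R), theta0 <= theta /\
    forall s, half_plane theta s -> dirichlet_sum a s (phi s).

Definition analytic_self_map (R : realType) (Phi : Cplx R -> Cplx R) : Prop :=
  holomorphic_on (half_plane 0) Phi /\
  forall s, half_plane 0 s -> half_plane 0 (Phi s).

Definition has_characteristic (R : realType) (Phi : Cplx R -> Cplx R)
    (c : nat) : Prop :=
  exists phi : Cplx R -> Cplx R, dirichlet_class 0 phi /\
    forall s, half_plane 0 s -> Phi s = c%:R * s + phi s.

Definition class_G_infty (R : realType) (Phi : Cplx R -> Cplx R) : Prop :=
  analytic_self_map Phi /\ exists c : nat, has_characteristic Phi c.

(* Only the values [Phi t] with [0 <= t] matter. *)
Definition continuous_semigroup (R : realType)
    (Phi : R -> Cplx R -> Cplx R) : Prop :=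
  [/\ forall t, 0 <= t -> analytic_self_map (Phi t),
      forall s, half_plane 0 s -> Phi 0 s = s,
      forall t u s, 0 <= t -> 0 <= u -> half_plane 0 s ->
        Phi t (Phi u s) = Phi (t + u) s
    & forall K : set (Cplx R), compact K -> K `<=` half_plane 0 ->
        {uniform K, Phi t @[t --> 0^'+] --> Phi 0}].

(* Main.v *)
(** A semigroup of holomorphic self-maps of the half-plane consists of injective
    maps: orbits stay in compact sets on bounded time intervals (Schwarz--Pick),
    and on a compact set [Phi h], being uniformly close to the identity, is
    injective for small [h] (Schwarz lemma).  A Dirichlet series
    [a_1 + a_N N^(-s) + ...] is not injective, being almost periodic with
    quasi-period [2 pi i / ln N]; hence no characteristic vanishes.  Comparing the
    growth of [Phi (t + u)] and [Phi t \o Phi u] along the positive real axis then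
    shows [c (t + u) = c t * c u], so [c t = c (t / 2) ^ 2] with [c t >= 1], and
    infinite descent leaves only [c t = 1].

    Pointwise complex differentiability is exploited through Goursat's theorem:
    the real part [a] of a holomorphic function is the [x]-derivative of a
    potential with vanishing discrete Laplacian at second order, whose difference
    quotients obey an elementary maximum principle.  This gives the maximum modulus
    principle, and with it the Schwarz lemma. *)
Require Import Defs.
From mathcomp Require Import all_boot all_order all_algebra.
From mathcomp Require Import all_classical all_reals all_analysis.
From mathcomp Require Import complex.
From mathcomp Require Import ring lra zify.
Set Implicit Arguments.
Unset Strict Implicit.
Unset Printing Implicit Defensive.
Import Order.TTheory GRing.Theory Num.Theory.
Import numFieldNormedType.Exports.
Local Open Scope classical_set_scope.
Local Open Scope ring_scope.

(** * Goursat's theorem and a maximum principle *)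

Section Goursat.
Variable R : realType.
Implicit Types (a b P Q : R -> R -> R) (x y h k e d : R).

(** This is the mean value theorem for [G - T]. Increments of antiderivatives stand for integrals,
    and [T] integrates a model [t] of [g]. *)
Lemma increment_approx (G g T t : R -> R) (x1 x2 e : R) : x1 <= x2 ->
  (forall x, x1 <= x <= x2 -> is_derive x 1 G (g x)) ->
  (forall x, x1 <= x <= x2 -> is_derive x 1 T (t x)) ->
  (forall x, x1 <= x <= x2 -> `|g x - t x| <= e) ->
  `|(G x2 - G x1) - (T x2 - T x1)| <= e * (x2 - x1).
Proof.
move=> x12 dG dT gt.
have dH x : x1 <= x <= x2 -> is_derive x 1 (G - T) (g x - t x).
  by move=> xx; have := dG _ xx; have := dT _ xx => ? ?; exact: is_deriveB.
have [||c cx] := @MVT_segment R (G - T) (fun x => g x - t x) x1 x2 x12.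
- by move=> x /[!in_itv]/= /andP[/ltW ? /ltW ?]; apply: dH; apply/andP.
- apply: derivable_within_continuous => x /[!in_itv]/= xx.
  by have [] := dH _ xx.
rewrite !fctE /= => E.
have -> : G x2 - G x1 - (T x2 - T x1) = G x2 - T x2 - (G x1 - T x1) by ring.
rewrite E normrM (ger0_norm (_ : 0 <= x2 - x1)) ?subr_ge0 //.
by rewrite ler_wpM2r ?subr_ge0 // gt //; move: cx; rewrite in_itv.
Qed.

Lemma increment_bound (G g : R -> R) (x1 x2 c e : R) : x1 <= x2 ->
  (forall x, x1 <= x <= x2 -> is_derive x 1 G (g x)) ->
  (forall x, x1 <= x <= x2 -> `|g x - c| <= e) ->
  `|(G x2 - G x1) - c * (x2 - x1)| <= e * (x2 - x1).
Proof.
move=> x12 dG gc.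
have := @increment_approx G g (fun x => c * x) (fun _ => c) x1 x2 e x12 dG.
rewrite (mulrBr c); apply; [move=> x _ | exact: gc].
have -> : (fun x => c * x) = c \*: (@id R) by [].
apply: is_derive_eq; exact: mulr1.
Qed.

Lemma increment_affine (G g : R -> R) (x1 x2 c p q e : R) : x1 <= x2 ->
  (forall x, x1 <= x <= x2 -> is_derive x 1 G (g x)) ->
  (forall x, x1 <= x <= x2 -> `|g x - (p + q * (x - c))| <= e) ->
  `|(G x2 - G x1) - (p * (x2 - x1) + q / 2 * ((x2 - c) ^+ 2 - (x1 - c) ^+ 2))|
    <= e * (x2 - x1).
Proof.
move=> x12 dG gc.
pose T := p \*: (@id R) + (q / 2) \*: ((fun x => x - c) ^+ 2).
have := @increment_approx G g T (fun x => p + q * (x - c)) x1 x2 e x12 dG.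
have -> : T x2 - T x1 = p * (x2 - x1) + q / 2 * ((x2 - c) ^+ 2 - (x1 - c) ^+ 2).
  by rewrite /T !fctE /= /GRing.scale /=; ring.
apply; [move=> x _ | exact: gc].
have dc : is_derive x 1 (fun x => x - c) (1 : R) := is_derive_shift x 1 (- c).
apply: (is_derive_eq (is_deriveD
  (is_deriveZ p (is_derive_id x 1)) (is_deriveZ (q / 2) (is_deriveX 2 dc)))).
by rewrite /GRing.scale /=; field.
Qed.

(** Real differentiability of [a + i b] with the Cauchy--Riemann equations built in; the complex
    derivative is [A + i B]. *)
Definition cauchy_riemann_at a b x y := exists A B : R, forall e, 0 < e ->
  exists2 d, 0 < d & forall h k, `|h| <= d -> `|k| <= d ->
    `|a (x + h) (y + k) - (a x y + A * h - B * k)| <= e * (`|h| + `|k|) /\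
    `|b (x + h) (y + k) - (b x y + B * h + A * k)| <= e * (`|h| + `|k|).

(* The integral of [a dx - b dy] around a rectangle, for antiderivatives [P y] of
   [a ^~ y] and [Q x] of [b x]. *)
Definition circulation P Q x1 x2 y1 y2 :=
  (P y1 x2 - P y1 x1) - (P y2 x2 - P y2 x1)
  - ((Q x2 y2 - Q x2 y1) - (Q x1 y2 - Q x1 y1)).

(** The affine parts cancel around the rectangle. What remains is the first-order error on four
    sides; with [e / 2] in place of [e], the four contributions add up to [e] times the squared
    half-perimeter. *)
Lemma circulation_local a b P Q x y e : 0 < e -> cauchy_riemann_at a b x y ->
  exists2 d, 0 < d & forall x1 x2 y1 y2,
    x1 <= x <= x2 -> y1 <= y <= y2 -> x2 - x1 <= d -> y2 - y1 <= d ->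
    (forall u v, x1 <= u <= x2 -> y1 <= v <= y2 ->
       is_derive u 1 (P v) (a u v) /\ is_derive v 1 (Q u) (b u v)) ->
    `|circulation P Q x1 x2 y1 y2| <= e * ((x2 - x1) + (y2 - y1)) ^+ 2.
Proof.
move=> e0 [A [B]] /(_ (e / 2)) []; first by rewrite divr_gt0.
move=> d d0 Hd; exists d => // x1 x2 y1 y2 xx yy dx dy D.
have x12 : x1 <= x2 by lra.
have y12 : y1 <= y2 by lra.
have near u v : x1 <= u <= x2 -> y1 <= v <= y2 ->
   `|a u v - (a x y + A * (u - x) - B * (v - y))| <= e / 2 * (x2 - x1 + (y2 - y1)) /\
   `|b u v - (b x y + B * (u - x) + A * (v - y))| <= e / 2 * (x2 - x1 + (y2 - y1)).
  move=> uu vv.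
  have hu : `|u - x| <= x2 - x1 by rewrite ler_norml; lra.
  have hv : `|v - y| <= y2 - y1 by rewrite ler_norml; lra.
  have [] := Hd (u - x) (v - y); [lra|lra|].
  rewrite (addrC x) (addrC y) !subrK => h1 h2.
  have L : e / 2 * (`|u - x| + `|v - y|) <= e / 2 * (x2 - x1 + (y2 - y1)).
    by rewrite ler_wpM2l ?lerD // divr_ge0 // ltW.
  by split; apply: le_trans L.
have HP v : y1 <= v <= y2 -> `|(P v x2 - P v x1) -
    ((a x y - B * (v - y)) * (x2 - x1) + A / 2 * ((x2 - x) ^+ 2 - (x1 - x) ^+ 2))|
    <= e / 2 * (x2 - x1 + (y2 - y1)) * (x2 - x1).
  move=> vv; apply: (@increment_affine _ (a^~ v)) => // u uu.
    by have [] := D _ _ uu vv.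
  by have [] := near _ _ uu vv; rewrite addrAC.
have HQ u : x1 <= u <= x2 -> `|(Q u y2 - Q u y1) -
    ((b x y + B * (u - x)) * (y2 - y1) + A / 2 * ((y2 - y) ^+ 2 - (y1 - y) ^+ 2))|
    <= e / 2 * (x2 - x1 + (y2 - y1)) * (y2 - y1).
  move=> uu; apply: (@increment_affine _ (b u)) => // v vv.
    by have [] := D _ _ uu vv.
  by have [] := near _ _ uu vv.
have := HP y1; have := HP y2; have := HQ x1; have := HQ x2.
rewrite !lexx x12 y12 !ler_norml => /(_ isT) /andP[? ?] /(_ isT) /andP[? ?].
move=> /(_ isT) /andP[? ?] /(_ isT) /andP[? ?].
rewrite /circulation; apply/andP; split; lra.
Qed.

(** Circulation is additive over the four quarters, since inner edges are traversed twice in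
    opposite directions; hence one quarter carries more than a fourth of it. *)
Lemma circulation_quarter P Q x y w h M :
  M * 4 < `|circulation P Q x (x + 2 * w) y (y + 2 * h)| -> 0 <= w -> 0 <= h ->
  exists x' y', [/\ x <= x' <= x + w, y <= y' <= y + h &
    M < `|circulation P Q x' (x' + w) y' (y' + h)|].
Proof.
move=> HM w0 h0; apply: contrapT => N.
have {}N x' y' : x <= x' <= x + w -> y <= y' <= y + h ->
   `|circulation P Q x' (x' + w) y' (y' + h)| <= M.
  by move=> xx yy; rewrite leNgt; apply/negP => ?; apply: N; exists x', y'.
have xl : x <= x <= x + w by lra.
have xr : x <= x + w <= x + w by lra.
have yl : y <= y <= y + h by lra.
have yr : y <= y + h <= y + h by lra.
have := N _ _ xl yl; have := N _ _ xl yr; have := N _ _ xr yl; have := N _ _ xr yr.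
move: HM; rewrite /circulation.
have -> : x + 2 * w = x + w + w by ring.
have -> : y + 2 * h = y + h + h by ring.
rewrite !ler_norml => HM /andP[? ?] /andP[? ?] /andP[? ?] /andP[? ?].
move: HM; rewrite ltNge => /negP; apply; rewrite ler_norml; apply/andP; split; lra.
Qed.

Lemma nested_point (u : R^nat) (w : R) :
  0 <= w -> (forall n, u n <= u n.+1) ->
  (forall n, u n.+1 + w / 2 ^+ n.+1 <= u n + w / 2 ^+ n) ->
  exists x, forall n, u n <= x <= u n + w / 2 ^+ n.
Proof.
move=> w0 ui ud.
have ui' m n : (m <= n)%N -> u m <= u n.
  by move=> mn; exact: (homo_leq (@lexx _ _) (@le_trans _ _) ui).
have ud' m n : (m <= n)%N -> u n + w / 2 ^+ n <= u m + w / 2 ^+ m.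
  have := @homo_leq _ (fun n => u n + w / 2 ^+ n) (fun x y : R => y <= x).
  by apply => // x y z /[swap]; exact: le_trans.
have wn n : 0 <= w / 2 ^+ n by rewrite divr_ge0 // exprn_ge0.
have uw m n : u m <= u n + w / 2 ^+ n.
  have [mn|/ltnW nm] := leqP m n.
    by apply: (le_trans (ui' _ _ mn)); rewrite lerDl.
  by apply: le_trans (ud' _ _ nm); rewrite lerDl.
have ub n : ubound (range u) (u n + w / 2 ^+ n) by move=> _ [m _ <-]; exact: uw.
exists (sup (range u)) => n; apply/andP; split.
  by apply: ub_le_sup; [exists (u 0%N + w / 2 ^+ 0); exact: ub|exists n].
by apply: ge_sup; [exists (u 0%N), 0%N|exact: ub].
Qed.

(** Goursat's bisection: a nonzero circulation yields nested rectangles whose circulation stays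
    above [e] times the squared half-perimeter, against [circulation_local] at their common
    point. *)
Lemma goursat a b P Q x1 x2 y1 y2 : x1 <= x2 -> y1 <= y2 ->
  (forall u v, x1 <= u <= x2 -> y1 <= v <= y2 -> cauchy_riemann_at a b u v /\
     is_derive u 1 (P v) (a u v) /\ is_derive v 1 (Q u) (b u v)) ->
  circulation P Q x1 x2 y1 y2 = 0.
Proof.
move=> x12 y12 D; apply/eqP; rewrite -normr_eq0 -[_ == 0]negbK.
apply/negP => J0; have {J0} : 0 < `|circulation P Q x1 x2 y1 y2|.
  by rewrite lt0r J0 /=.
pose w := x2 - x1; pose h := y2 - y1.
have -> : x2 = x1 + w by rewrite /w; ring.
have -> : y2 = y1 + h by rewrite /h; ring.
set J := `|_| => J0.
have w0 : 0 <= w by rewrite subr_ge0.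
have h0 : 0 <= h by rewrite subr_ge0.
(* With this [e] the full rectangle is already [bad]; the [+ 1] covers degenerate rectangles, where
   [w + h = 0]. *)
pose e := J / (2 * (w + h + 1) ^+ 2).
have S0 : 0 < (w + h + 1) ^+ 2 by rewrite exprn_gt0 //; lra.
have e0 : 0 < e by rewrite divr_gt0 // mulr_gt0.
pose bad (n : nat) (p : R * R) := [/\ x1 <= p.1, p.1 + w / 2 ^+ n <= x2,
  y1 <= p.2, p.2 + h / 2 ^+ n <= y2 &
  e * (w / 2 ^+ n + h / 2 ^+ n) ^+ 2 <
   `|circulation P Q p.1 (p.1 + w / 2 ^+ n) p.2 (p.2 + h / 2 ^+ n)|].
have half (t : R) n : t / 2 ^+ n = 2 * (t / 2 ^+ n.+1).
  by rewrite exprS; field; rewrite expf_neq0.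
(* The hypothesis [bad] sits under the existential, so that choice yields a total successor map on
   all pairs. *)
have /choice [nx nxP] : forall q : nat * (R * R), exists p', bad q.1 q.2 ->
   bad q.1.+1 p' /\ (q.2.1 <= p'.1 <= q.2.1 + w / 2 ^+ q.1.+1 /\
                     q.2.2 <= p'.2 <= q.2.2 + h / 2 ^+ q.1.+1).
  move=> [n [x y]] /=; have [B|B] := pselect (bad n (x, y)); last by exists (x, y).
  case: B => /= b1 b2 b3 b4 b5.
  have wn : 0 <= w / 2 ^+ n.+1 by rewrite divr_ge0 // exprn_ge0.
  have hn : 0 <= h / 2 ^+ n.+1 by rewrite divr_ge0 // exprn_ge0.
  move: b2 b4 b5; rewrite (half w n) (half h n) => b2 b4 b5.
  have [|||x' [y' [xx yy E]]] := @circulation_quarter P Q x y (w / 2 ^+ n.+1)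
      (h / 2 ^+ n.+1) (e * (w / 2 ^+ n.+1 + h / 2 ^+ n.+1) ^+ 2) => //.
    by apply: le_lt_trans b5; rewrite -mulrDr exprMn; lra.
  exists (x', y') => _; split => //=; split => //=; lra.
pose s := fix s n := if n is n'.+1 then nx (n', s n') else (x1, y1).
have sbad n : bad n (s n).
  elim: n => [|n IH]; last by have [] := nxP (n, s n) IH.
  split => /=; rewrite ?expr0 ?divr1 ?lexx //; [rewrite /w; lra|rewrite /h; lra|].
  rewrite -/J /e -mulrA gtr_pMr // invfM -mulrA.
  have L : (w + h) ^+ 2 <= (w + h + 1) ^+ 2 by rewrite ler_sqr ?nnegrE; lra.
  have : ((w + h + 1) ^+ 2)^-1 * (w + h) ^+ 2 <= 1 by rewrite mulrC ler_pdivrMr // mul1r.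
  lra.
have [||u xs] := @nested_point (fun n => (s n).1) w w0.
- by move=> n; have [_ [/andP[]]] := nxP (n, s n) (sbad n).
- move=> n; have := nxP (n, s n) (sbad n) => /= -[_ [/andP[? ?] _]].
  by rewrite (half w n) /=; lra.
have [||v ys] := @nested_point (fun n => (s n).2) h h0.
- by move=> n; have [_ [_ /andP[]]] := nxP (n, s n) (sbad n).
- move=> n; have := nxP (n, s n) (sbad n) => /= -[_ [_ /andP[? ?]]].
  by rewrite (half h n) /=; lra.
have uu : x1 <= u <= x2.
  by have := xs 0%N; rewrite /= expr0 divr1 /w; lra.
have vv : y1 <= v <= y2.
  by have := ys 0%N; rewrite /= expr0 divr1 /h; lra.
have [CR _] := D _ _ uu vv.
have [d d0 Hd] := circulation_local P Q e0 CR.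
have [n dn] : exists n : nat, (w + h) / 2 ^+ n <= d.
  exists (Num.bound ((w + h) / d)).
  rewrite ler_pdivrMr ?exprn_gt0 // mulrC -ler_pdivrMr //.
  apply: ltW; apply: lt_le_trans (archi_boundP _) _.
    by apply: divr_ge0; [lra|exact: ltW].
  by rewrite -natrX ler_nat ltnW // ltn_expl.
have [b1 b2 b3 b4] := sbad n; apply/negP; rewrite -leNgt.
have wn : 0 <= w / 2 ^+ n by rewrite divr_ge0 // exprn_ge0.
have hn : 0 <= h / 2 ^+ n by rewrite divr_ge0 // exprn_ge0.
move: dn; rewrite mulrDl => dn.
have := Hd (s n).1 ((s n).1 + w / 2 ^+ n) (s n).2 ((s n).2 + h / 2 ^+ n) (xs n) (ys n).
have E (p q : R) : p + q - p = q by ring.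
rewrite !E; apply; [lra|lra|].
move=> u' v' u'P v'P; have [||_ //] := D u' v'; lra.
Qed.

End Goursat.

(** * Antiderivatives and the maximum principle for small discrete Laplacians *)

Section DiscreteLaplacian.
Variable R : realType.
Implicit Types (a b P Q : R -> R -> R) (x y h k e d : R).

Lemma antiderivative (g : R -> R) (l r : R) : l < r ->
  (forall x, l <= x <= r -> {for x, continuous g}) ->
  exists G : R -> R, forall x, l < x < r -> is_derive x 1 G (g x).
Proof.
move=> lr cg.
have intg : (@lebesgue_measure R).-integrable `[l, r] (EFin \o g).
  apply: continuous_compact_integrable; first exact: segment_compact.
  apply: continuous_in_subspaceT => x /[!inE] /= /[!in_itv]/=.
  exact: cg.
eexists => x /andP[lx xr].
have lxr : l <= x <= r by rewrite !ltW.
have [D E] := continuous_FTC1_closed xr intg lx (cg _ lxr).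
by apply: DeriveDef; [exact: D|rewrite -derive1E].
Qed.

Lemma cauchy_riemann_lipschitz a b x y : cauchy_riemann_at a b x y ->
  exists C d, [/\ 0 < C, 0 < d & forall u v, `|u - x| <= d -> `|v - y| <= d ->
    `|a u v - a x y| <= C * (`|u - x| + `|v - y|) /\
    `|b u v - b x y| <= C * (`|u - x| + `|v - y|)].
Proof.
move=> [A [B /(_ 1 ltr01) [d d0 Hd]]].
exists (`|A| + `|B| + 1), d; split => //.
move=> u v ud vd; have [] := Hd _ _ ud vd; rewrite (addrC x) (addrC y) !subrK.
set s := u - x; set t := v - y => Ha Hb.
have [As Bs At Bt] : [/\ `|A * s| = `|A| * `|s|, `|B * s| = `|B| * `|s|,
   `|A * t| = `|A| * `|t| & `|B * t| = `|B| * `|t|] by rewrite !normrM.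
have ? : 0 <= `|A| * `|t| by rewrite mulr_ge0.
have ? : 0 <= `|B| * `|s| by rewrite mulr_ge0.
have ? : 0 <= `|A| * `|s| by rewrite mulr_ge0.
have ? : 0 <= `|B| * `|t| by rewrite mulr_ge0.
have EA : a u v - a x y = a u v - (a x y + A * s - B * t) + (A * s - B * t) by ring.
have EB : b u v - b x y = b u v - (b x y + B * s + A * t) + (B * s + A * t) by ring.
split.
  rewrite EA; apply: (le_trans (ler_normD _ _)).
  by have := ler_normB (A * s) (B * t); lra.
rewrite EB; apply: (le_trans (ler_normD _ _)).
by have := ler_normD (B * s) (A * t); lra.
Qed.

Lemma continuous_eps (g : R -> R) x :
  (forall e, 0 < e -> exists2 d, 0 < d & forall t, `|t - x| <= d -> `|g t - g x| <= e) ->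
  {for x, continuous g}.
Proof.
move=> H; apply/cvgrPdist_le => e e0; have [d d0 Hd] := H _ e0.
apply/nbhs_normP; exists d => // t /= td; rewrite distrC; apply: Hd.
by rewrite distrC ltW.
Qed.

Lemma cauchy_riemann_continuous a b x y : cauchy_riemann_at a b x y ->
  {for x, continuous (a^~ y)} /\ {for y, continuous (b x)}.
Proof.
move=> /cauchy_riemann_lipschitz [C [d [C0 d0 H]]].
have z (t : R) : `|t - t| = 0 by rewrite subrr normr0.
by split; apply: continuous_eps => e e0; exists (Order.min d (e / C));
  rewrite ?lt_min ?d0 ?divr_gt0 // => t; rewrite le_min => /andP[td te];
  [have [] := H t y td | have [] := H x t]; rewrite ?z ?(ltW d0) ?addr0 ?add0r //;
  [move=> L _|move=> _ L]; apply: (le_trans L); rewrite mulrC -ler_pdivlMr.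
Qed.

(** The gradient of [F] is [(a, - b)], and the slopes of [a] in [x] and of [- b] in [y] are [A] and
    [- A]: the second-order terms cancel. Each of the four increments leaves an error
    [e / 4 * k ^+ 2]. *)
Lemma potential_laplacian a b (F : R -> R -> R) x y r e : 0 < r -> 0 < e ->
  cauchy_riemann_at a b x y ->
  (forall u, `|u - x| <= r -> is_derive u 1 (F^~ y) (a u y)) ->
  (forall v, `|v - y| <= r -> is_derive v 1 (F x) (- b x v)) ->
  exists2 d, 0 < d & forall k, 0 < k <= d ->
    `|F (x + k) y + F (x - k) y + F x (y + k) + F x (y - k) - 4 * F x y|
      <= e * k ^+ 2.
Proof.
move=> r0 e0 [A [B]] /(_ (e / 4)) []; first by rewrite divr_gt0.
move=> d d0 Hd DP DQ.
exists (Order.min d r); first by rewrite lt_min d0.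
move=> k; rewrite le_min => /andP[k0 /andP[kd kr]].
have Pa u : `|u - x| <= k -> `|a u y - (a x y + A * (u - x))| <= e / 4 * k.
  move=> uk; have [] := Hd (u - x) 0; [exact: le_trans kd|by rewrite normr0 ltW|].
  rewrite normr0 !addr0 mulr0 subr0 (addrC x) subrK => H _.
  by apply: (le_trans H); rewrite ler_wpM2l // divr_ge0 // ltW.
have Qb v : `|v - y| <= k -> `|- b x v - (- b x y + - A * (v - y))| <= e / 4 * k.
  move=> vk; have [] := Hd 0 (v - y); [by rewrite normr0 ltW|exact: le_trans kd|].
  rewrite normr0 add0r !addr0 !mulr0 !addr0 (addrC y) subrK => _ H.
  have -> : - b x v - (- b x y + - A * (v - y)) =
    - (b x v - (b x y + A * (v - y))) by ring.
  by rewrite normrN; apply: (le_trans H); rewrite ler_wpM2l // divr_ge0 // ltW.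
have nk (u c : R) : c - k <= u <= c + k -> `|u - c| <= k by rewrite ler_norml; lra.
have E1 (G g : R -> R) (c p q : R) :
    (forall u, `|u - c| <= r -> is_derive u 1 G (g u)) ->
    (forall u, `|u - c| <= k -> `|g u - (p + q * (u - c))| <= e / 4 * k) ->
    `|G (c + k) - G c - (p * k + q / 2 * k ^+ 2)| <= e / 4 * k * k /\
    `|G c - G (c - k) - (p * k - q / 2 * k ^+ 2)| <= e / 4 * k * k.
  move=> dG gG; clear - dG gG k0 kr nk.
  have dG' u : c - k <= u <= c + k -> is_derive u 1 G (g u).
    by move=> uk; apply: dG; apply: le_trans kr; exact: nk.
  have gG' u : c - k <= u <= c + k -> `|g u - (p + q * (u - c))| <= e / 4 * k.
    by move=> uk; apply: gG; exact: nk.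
  split.
    have := @increment_affine _ G g c (c + k) c p q (e / 4 * k).
    have -> : c + k - c = k by ring.
    rewrite subrr expr0n /= subr0; apply; first lra.
      by move=> u uu; apply: dG'; lra.
    by move=> u uu; apply: gG'; lra.
  have := @increment_affine _ G g (c - k) c c p q (e / 4 * k).
  have -> : c - (c - k) = k by ring.
  have -> : c - k - c = - k by ring.
  rewrite subrr expr0n /= sub0r sqrrN mulrN; apply; first lra.
    by move=> u uu; apply: dG'; lra.
  by move=> u uu; apply: gG'; lra.
have [P1 P2] := E1 (F^~ y) (a^~ y) x _ _ DP Pa.
have [Q1 Q2] := E1 (F x) (fun v => - b x v) y _ _ DQ Qb.
clear - P1 P2 Q1 Q2.
move: P1 P2 Q1 Q2; rewrite !ler_norml => /andP[? ?] /andP[? ?] /andP[? ?] /andP[? ?].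
apply/andP; split; lra.
Qed.

(** A small multiple [c] of the squared distance to the centre is added to [H]. At an interior
    maximum of the sum, the discrete Laplacian would be nonpositive, yet it is at least
    [4 * c * k ^+ 2 - c * k ^+ 2]. *)
Lemma square_max_principle (H : R -> R -> R) x0 y0 r M : 0 < r ->
  (forall x y, `|x - x0| <= r -> `|y - y0| <= r -> forall e, 0 < e ->
     exists2 d, 0 < d & forall x' y', `|x' - x| <= d -> `|y' - y| <= d ->
       `|H x' y' - H x y| <= e) ->
  (forall x y, `|x - x0| < r -> `|y - y0| < r -> forall e, 0 < e ->
     exists2 d, 0 < d & forall k, 0 < k <= d ->
     `|H (x + k) y + H (x - k) y + H x (y + k) + H x (y - k) - 4 * H x y| <= e * k ^+ 2) ->
  (forall x y, `|x - x0| <= r -> `|y - y0| <= r ->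
     `|x - x0| = r \/ `|y - y0| = r -> H x y <= M) ->
  forall x y, `|x - x0| <= r -> `|y - y0| <= r -> H x y <= M.
Proof.
move=> r0 cH lH bH x1 y1 xr1 yr1; rewrite leNgt; apply/negP => HM.
have r20 : 0 < r ^+ 2 by rewrite exprn_gt0.
(* On the square the perturbation is at most [2 * c * r ^+ 2], half of the excess of [H x1 y1] over
   [M]. So [H] still exceeds [M] where [W] is maximal, and that point is interior. *)
pose c := (H x1 y1 - M) / (4 * r ^+ 2).
have c0 : 0 < c by rewrite divr_gt0 ?subr_gt0 // mulr_gt0.
have cE : c * (4 * r ^+ 2) = H x1 y1 - M by rewrite /c divfK // mulf_neq0 ?gt_eqF.
have sq (t : R) : `|t| <= r -> t ^+ 2 <= r ^+ 2.
  by move=> tr; rewrite -real_normK ?num_real // ler_sqr ?nnegrE ?(ltW r0).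
pose W (p : R * R) := H p.1 p.2 + c * ((p.1 - x0) ^+ 2 + (p.2 - y0) ^+ 2).
pose S := `[x0 - r, x0 + r] `*` `[y0 - r, y0 + r].
have inS p : S p <-> `|p.1 - x0| <= r /\ `|p.2 - y0| <= r.
  by rewrite /S /= !in_itv /= !ler_distl.
have cW : {within S, continuous W}.
  apply: continuous_in_subspaceT => -[x y] /[!inE] /inS /= [xr yr].
  apply: cvgD; last first.
    apply: cvgM; first exact: cvg_cst.
    by apply: cvgD; apply: cvgM; apply: cvgB;
       (try exact: cvg_cst); (try exact: cvg_fst); exact: cvg_snd.
  apply/cvgrPdist_le => e e0; have [d d0 Hd] := cH _ _ xr yr _ e0.
  exists (ball x d, ball y d); first by split; apply: nbhsx_ballx.
  move=> [x' y'] /= [xd yd]; rewrite distrC; apply: Hd; rewrite distrC ltW //.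
have S1 : S (x1, y1) by apply/inS.
have S0 : S !=set0 by exists (x1, y1).
have cS : compact S by apply: compact_setX; exact: segment_compact.
have [[x y] /[!inE] /inS /= [xr yr] max] := compact_EVT_max S0 cS cW.
have {}max x' y' : `|x' - x0| <= r -> `|y' - y0| <= r -> W (x', y') <= W (x, y).
  by move=> ? ?; apply: max; rewrite inE; apply/inS.
have Hxy : M < H x y.
  have := max _ _ xr1 yr1; rewrite /W /=.
  have := sq _ xr; have := sq _ yr => ? ? E.
  have : 0 <= c * ((x1 - x0) ^+ 2 + (y1 - y0) ^+ 2).
    by apply: mulr_ge0; [exact: ltW|apply: addr_ge0; exact: sqr_ge0].
  have : c * ((x - x0) ^+ 2 + (y - y0) ^+ 2) <= c * (2 * r ^+ 2).
    by rewrite ler_pM2l //; lra.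
  have := mulr_gt0 c0 r20; lra.
have xr' : `|x - x0| < r.
  rewrite lt_neqAle xr andbT; apply/negP => /eqP E.
  by have := bH _ _ xr yr (or_introl E); rewrite leNgt Hxy.
have yr' : `|y - y0| < r.
  rewrite lt_neqAle yr andbT; apply/negP => /eqP E.
  by have := bH _ _ xr yr (or_intror E); rewrite leNgt Hxy.
have [d d0 Hd] := lH _ _ xr' yr' _ c0.
(* The four neighbours at distance [k] remain in the square. *)
pose k := Order.min d (Order.min (r - `|x - x0|) (r - `|y - y0|)).
have k0 : 0 < k by rewrite !lt_min d0 !subr_gt0 xr' yr'.
have kd : k <= d by rewrite ge_min lexx.
have kx : k <= r - `|x - x0| by rewrite !ge_min lexx !orbT.
have ky : k <= r - `|y - y0| by rewrite !ge_min lexx !orbT.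
have shift (s t c' : R) : `|s| = k -> k <= r - `|t - c'| -> `|t + s - c'| <= r.
  by move=> sk kr; rewrite addrAC; apply: le_trans (ler_normD _ _) _; lra.
have nk : `|k| = k by rewrite gtr0_norm.
have nNk : `|- k| = k by rewrite normrN.
have := Hd k; rewrite k0 kd => /(_ isT); rewrite ler_norml => /andP[L _].
have := max _ _ (shift _ _ _ nk kx) yr; have := max _ _ (shift _ _ _ nNk kx) yr.
have := max _ _ xr (shift _ _ _ nk ky); have := max _ _ xr (shift _ _ _ nNk ky).
rewrite /W /= => ? ? ? ?.
have : 0 < c * k ^+ 2 by rewrite mulr_gt0 // exprn_gt0.
nra.
Qed.

End DiscreteLaplacian.

(** * Potentials of closed forms and the maximum principle for real parts *)

Section Potential.
Variable R : realType.
Implicit Types (a b P Q : R -> R -> R) (x y h k e d : R).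

Lemma increment_le (G g : R -> R) (x1 x2 M : R) : x1 <= x2 ->
  (forall x, x1 <= x <= x2 -> is_derive x 1 G (g x)) ->
  (forall x, x1 <= x <= x2 -> g x <= M) ->
  G x2 - G x1 <= M * (x2 - x1).
Proof.
move=> x12 dG gM; have [||c cx ->] := @MVT_segment R G g x1 x2 x12.
- by move=> x /[!in_itv]/= /andP[/ltW ? /ltW ?]; apply: dG; apply/andP.
- apply: derivable_within_continuous => x /[!in_itv]/= xx.
  by have [] := dG _ xx.
by rewrite ler_wpM2r ?subr_ge0 // gM //; move: cx; rewrite in_itv.
Qed.

Lemma increment_lipschitz (G g : R -> R) (c d K u v : R) :
  (forall x, `|x - c| <= d -> is_derive x 1 G (g x)) ->
  (forall x, `|x - c| <= d -> `|g x| <= K) ->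
  `|u - c| <= d -> `|v - c| <= d -> `|G u - G v| <= K * `|u - v|.
Proof.
move=> dG gK; wlog vu : u v / v <= u => [L|] uc vc.
  have [/L|/ltW/L L'] := leP v u; first by apply.
  by rewrite distrC (distrC u); exact: L'.
have W x : v <= x <= u -> `|x - c| <= d.
  by move: uc vc; rewrite !ler_distl; lra.
have := @increment_bound _ G g v u 0 K vu; rewrite mul0r subr0.
have -> : `|u - v| = u - v by rewrite ger0_norm // subr_ge0.
move=> H; apply: H => x /W ?; first exact: dG.
by rewrite subr0 gK.
Qed.

(** [F] integrates [a dx - b dy] from the corner [(xl, yl)], first horizontally and then vertically,
    which gives the derivative in [y]. By Goursat the other order gives the same value, hence the
    derivative in [x]. The antiderivatives are differentiable only inside the square of radius [r'],
    whence [r < r']. *)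
Lemma exists_potential a b x0 y0 r r' : 0 < r < r' ->
  (forall x y, `|x - x0| <= r' -> `|y - y0| <= r' -> cauchy_riemann_at a b x y) ->
  exists F : R -> R -> R, forall x y, `|x - x0| < r -> `|y - y0| < r ->
    is_derive x 1 (F^~ y) (a x y) /\ is_derive y 1 (F x) (- b x y).
Proof.
move=> /andP[r0 rr'] CR; have r'0 := lt_trans r0 rr'.
have /choice [P dP] : forall y, exists G : R -> R, `|y - y0| <= r' ->
    forall x, `|x - x0| < r' -> is_derive x 1 G (a x y).
  move=> y; have [yR|] := boolP (`|y - y0| <= r'); last by exists id.
  have [||G HG] := @antiderivative R (a^~ y) (x0 - r') (x0 + r'); first lra.
    move=> x xx; have xR : `|x - x0| <= r' by rewrite ler_distl.
    by have [] := cauchy_riemann_continuous (CR _ _ xR yR).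
  by exists G => _ x xR; apply: HG; rewrite -ltr_distl.
have /choice [Q dQ] : forall x, exists G : R -> R, `|x - x0| <= r' ->
    forall y, `|y - y0| < r' -> is_derive y 1 G (b x y).
  move=> x; have [xR|] := boolP (`|x - x0| <= r'); last by exists id.
  have [||G HG] := @antiderivative R (b x) (y0 - r') (y0 + r'); first lra.
    move=> y yy; have yR : `|y - y0| <= r' by rewrite ler_distl.
    by have [] := cauchy_riemann_continuous (CR _ _ xR yR).
  by exists G => _ y yR; apply: HG; rewrite -ltr_distl.
pose xl := x0 - r; pose yl := y0 - r.
pose F x y := P yl x - P yl xl - (Q x y - Q x yl).
(* The path that goes vertically first. *)
have FE x y : `|x - x0| <= r -> `|y - y0| <= r ->
    F x y = P y x - P y xl - (Q xl y - Q xl yl).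
  rewrite !ler_distl => xR yR.
  have : circulation P Q xl x yl y = 0.
    apply: (@goursat _ a b); [rewrite /xl; lra|rewrite /yl; lra|].
    move=> u v uu vv.
    have uR : `|u - x0| < r' by rewrite ltr_distl; rewrite /xl in uu; lra.
    have vR : `|v - y0| < r' by rewrite ltr_distl; rewrite /yl in vv; lra.
    by split; [apply: CR; exact: ltW|split; [apply: dP => //; exact: ltW|
      apply: dQ => //; exact: ltW]].
  by rewrite /circulation /F; lra.
exists F => x y xr yr.
have xr' := lt_trans xr rr'; have yr' := lt_trans yr rr'.
split.
  apply: (@near_eq_is_derive _ _ _ (P y - cst (P y xl + (Q xl y - Q xl yl)))).
    apply/nbhs_normP; exists (r - `|x - x0|); first by rewrite /= subr_gt0.
    move=> t /= xt; rewrite !fctE FE; [ring| |exact: ltW].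
    have -> : t - x0 = (t - x) + (x - x0) by ring.
    by apply: (le_trans (ler_normD _ _)); rewrite (distrC t); lra.
  rewrite -[a x y]subr0; apply: is_deriveB; apply: dP => //; exact: ltW.
rewrite -[- b x y]sub0r; apply: is_deriveB.
rewrite -[b x y]subr0; apply: is_deriveB; apply: dQ => //; exact: ltW.
Qed.

(** Both partial derivatives are bounded near the point, so [F] is Lipschitz there along the path
    through [(x, y')]. *)
Lemma potential_continuous a b (F : R -> R -> R) x y r e :
  cauchy_riemann_at a b x y -> 0 < r -> 0 < e ->
  (forall u v, `|u - x| <= r -> `|v - y| <= r ->
    is_derive u 1 (F^~ v) (a u v) /\ is_derive v 1 (F u) (- b u v)) ->
  exists2 d, 0 < d & forall x' y', `|x' - x| <= d -> `|y' - y| <= d ->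
    `|F x' y' - F x y| <= e.
Proof.
move=> CR r0 e0 dF; have [L [d1 [L0 d10 HL]]] := cauchy_riemann_lipschitz CR.
have [d2 [d20 d21 d2r]] : exists d2, [/\ 0 < d2, d2 <= d1 & d2 <= r].
  by exists (Order.min d1 r); rewrite lt_min d10 r0 !ge_min !lexx orbT.
pose K := `|a x y| + `|b x y| + 2 * L * d2 + 1.
have Ld : 0 <= 2 * L * d2 by rewrite !mulr_ge0 // ltW.
have K0 : 0 < K by rewrite ltr_wpDl // !addr_ge0.
have Kab u v : `|u - x| <= d2 -> `|v - y| <= d2 -> `|a u v| <= K /\ `|- b u v| <= K.
  move=> ux vy; have [Ha Hb] := HL u v (le_trans ux d21) (le_trans vy d21).
  have Luv : L * (`|u - x| + `|v - y|) <= 2 * L * d2.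
    by rewrite (mulrC 2) -mulrA ler_pM2l //; lra.
  have Ta := ler_normD (a u v - a x y) (a x y).
  have Tb := ler_normD (b u v - b x y) (b x y).
  rewrite !subrK in Ta Tb; rewrite normrN /K.
  have := normr_ge0 (a x y); have := normr_ge0 (b x y).
  clear - Ha Hb Luv Ta Tb; lra.
exists (Order.min d2 (e / (2 * K))).
  by rewrite lt_min d20 divr_gt0 // mulr_gt0.
move=> x' y'; rewrite !le_min => /andP[xd xe] /andP[yd ye].
have z (s : R) : `|s - s| <= d2 by rewrite subrr normr0 ltW.
have -> : F x' y' - F x y = (F x' y' - F x y') + (F x y' - F x y) by ring.
have E1 : `|F x' y' - F x y'| <= K * `|x' - x|.
  apply: (@increment_lipschitz (F^~ y') (a^~ y') x d2);
    [move=> u ux|move=> u ux|exact: xd|exact: z].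
    by have [] := dF u y' (le_trans ux d2r) (le_trans yd d2r).
  by have [] := Kab u y' ux yd.
have E2 : `|F x y' - F x y| <= K * `|y' - y|.
  apply: (@increment_lipschitz (F x) (fun v => - b x v) y d2);
    [move=> v vy|move=> v vy|exact: yd|exact: z].
    by have [] := dF x v (le_trans (z _) d2r) (le_trans vy d2r).
  by have [] := Kab x v (z x) vy.
have K1 (s : R) : s <= e / (2 * K) -> K * s <= e / 2.
  by rewrite invfM mulrA ler_pdivlMr // mulrC.
have H1 := K1 _ xe; have H2 := K1 _ ye.
by apply: (le_trans (ler_normD _ _)); clear - E1 E2 H1 H2; lra.
Qed.

(* The difference quotients of the potential [F] in the first variable satisfy
   the maximum principle and converge to [a]. *)
Lemma cauchy_riemann_max a b x0 y0 R1 R2 M : 0 <= R1 < R2 ->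
  (forall x y, `|x - x0| <= R2 -> `|y - y0| <= R2 -> cauchy_riemann_at a b x y) ->
  (forall x y, `|x - x0| <= R2 -> `|y - y0| <= R2 ->
     R1 <= `|x - x0| \/ R1 <= `|y - y0| -> a x y <= M) ->
  forall x y, `|x - x0| <= R1 -> `|y - y0| <= R1 -> a x y <= M.
Proof.
move=> /andP[R10 R12] CR aM.
(* The radii are [R1], [r = R1 + t], [R3 = R1 + 3 t] and [R2 = R1 + 4 t]. A translation by [s <= t]
   then keeps the square of radius [r] inside the domain of [F], and keeps its boundary outside the
   open square of radius [R1]. *)
pose t := (R2 - R1) / 4; have t0 : 0 < t by rewrite divr_gt0 // subr_gt0.
have [r [R3 [R1r rR3 R32]]] : exists r R3, [/\ r = R1 + t, R3 = r + 2 * t & R3 + t = R2].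
  by exists (R1 + t), (R1 + t + 2 * t); split => //; rewrite /t; field.
clearbody t.
have [||F dF] := @exists_potential a b x0 y0 R3 R2; [lra|exact: CR|].
have in3 (u c : R) : `|u - c| <= r + t -> `|u - c| < R3.
  by move=> H; apply: (le_lt_trans H); lra.
have in2 (u c : R) : `|u - c| <= r + t -> `|u - c| <= R2.
  by move=> H; apply: (le_trans H); lra.
have tri (u v c d d' : R) : `|v - c| <= d -> `|u - v| <= d' -> `|u - c| <= d + d'.
  move=> vc uv; have -> : u - c = (v - c) + (u - v) by ring.
  exact: le_trans (ler_normD _ _) (lerD vc uv).
have dF3 x y u v : `|x - x0| <= r + t -> `|y - y0| <= r + t ->
    `|u - x| <= t / 2 -> `|v - y| <= t / 2 ->
    is_derive u 1 (F^~ v) (a u v) /\ is_derive v 1 (F u) (- b u v).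
  by move=> xr yr ux vy; apply: dF; apply: le_lt_trans (tri _ _ _ _ _ _ _) _; eauto; lra.
have t20 : 0 < t / 2 by rewrite divr_gt0.
have zt (u : R) : `|u - u| <= t / 2 by rewrite subrr normr0 ltW.
have cF x y e : `|x - x0| <= r + t -> `|y - y0| <= r + t -> 0 < e ->
   exists2 d, 0 < d & forall x' y', `|x' - x| <= d -> `|y' - y| <= d ->
       `|F x' y' - F x y| <= e.
  move=> xr yr e0; apply: potential_continuous (CR _ _ (in2 _ _ xr) (in2 _ _ yr)) t20 e0 _.
  by move=> u v; exact: dF3.
have lF x y e : `|x - x0| <= r + t -> `|y - y0| <= r + t -> 0 < e ->
   exists2 d, 0 < d & forall k, 0 < k <= d ->
     `|F (x + k) y + F (x - k) y + F x (y + k) + F x (y - k) - 4 * F x y| <= e * k ^+ 2.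
  move=> xr yr e0; apply: potential_laplacian t20 e0 (CR _ _ (in2 _ _ xr) (in2 _ _ yr)) _ _.
    by move=> u ux; have [] := dF3 _ _ _ _ xr yr ux (zt y).
  by move=> v vy; have [] := dF3 _ _ _ _ xr yr (zt x) vy.
have wide (u c : R) : `|u - c| <= r -> `|u - c| <= r + t.
  by move=> H; apply: (le_trans H); rewrite lerDl ltW.
have shift (u c s : R) : 0 < s <= t -> `|u - c| <= r -> `|u + s - c| <= r + t.
  move=> /andP[s0 st] uc; apply: tri uc _.
  by rewrite addrAC subrr add0r gtr0_norm.
have r0 : 0 < r by rewrite R1r ltr_wpDl.
(* A difference of two translates of [F] again has a small discrete Laplacian; on the boundary, the
   mean value theorem and [a <= M] bound it by [M * s]. *)
have HM s : 0 < s <= t -> forall x y, `|x - x0| <= r -> `|y - y0| <= r ->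
    F (x + s) y - F x y <= M * s.
  move=> st; apply: square_max_principle => //.
  - move=> x y xr yr e e0; have e20 : 0 < e / 2 by rewrite divr_gt0.
    have [d d0 Hd] := cF _ _ _ (wide _ _ xr) (wide _ _ yr) e20.
    have [d' d'0 Hd'] := cF _ _ _ (shift _ _ _ st xr) (wide _ _ yr) e20.
    exists (Order.min d d'); first by rewrite lt_min d0.
    move=> x' y'; rewrite !le_min => /andP[xd xd'] /andP[yd yd'].
    have -> : F (x' + s) y' - F x' y' - (F (x + s) y - F x y) =
      (F (x' + s) y' - F (x + s) y) - (F x' y' - F x y) by ring.
    apply: (le_trans (ler_normB _ _)); rewrite [leRHS]splitr.
    by apply: lerD; [apply: Hd' => //; rewrite opprD addrACA subrr addr0|exact: Hd].
  - move=> x y /ltW xr /ltW yr e e0; have e20 : 0 < e / 2 by rewrite divr_gt0.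
    have [d d0 Hd] := lF _ _ _ (wide _ _ xr) (wide _ _ yr) e20.
    have [d' d'0 Hd'] := lF _ _ _ (shift _ _ _ st xr) (wide _ _ yr) e20.
    exists (Order.min d d'); first by rewrite lt_min d0.
    move=> k; rewrite le_min => /andP[k0 /andP[kd kd']].
    have := Hd k; have := Hd' k; rewrite k0 kd kd' => /(_ isT) H1 /(_ isT) H2.
    rewrite (addrAC x s k) (addrAC x s (- k)) in H1.
    by move: H1 H2; clear; rewrite !ler_norml => /andP[? ?] /andP[? ?]; apply/andP; split; lra.
  move=> x y xr yr xyr.
  have := @increment_le (F^~ y) (a^~ y) x (x + s) M.
  rewrite (_ : x + s - x = s); last by ring.
  have xs u : x <= u <= x + s -> `|u - x| <= s by rewrite ler_distl; lra.
  case/andP: (st) => s0 s_le_t.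
  have xt u : x <= u <= x + s -> `|u - x0| <= r + t.
    by move=> /xs us; apply: tri xr _; exact: le_trans s_le_t.
  apply; first by rewrite lerDl ltW.
    by move=> u /xt ut; have [] := dF u y (in3 _ _ ut) (in3 _ _ (wide _ _ yr)).
  move=> u uu; apply: aM; [exact/in2/xt|exact/in2/wide|].
  case: xyr => [E|->]; [left|by right; rewrite R1r lerDl ltW].
  have ux := xs _ uu; have := lerB_dist (x - x0) (x - u).
  have -> : x - x0 - (x - u) = u - x0 by ring.
  by rewrite E (distrC x u) R1r; clear - ux s_le_t; lra.
move=> x y xR1 yR1; rewrite leNgt; apply/negP => axy.
have R1r' (u : R) : u <= R1 -> u <= r.
  by move=> H; rewrite R1r; apply: (le_trans H); rewrite lerDl ltW.
have xr := R1r' _ xR1; have yr := R1r' _ yR1.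
have [L [d [L0 d0 HL]]] := cauchy_riemann_lipschitz
  (CR _ _ (in2 _ _ (wide _ _ xr)) (in2 _ _ (wide _ _ yr))).
(* If [a x y = M + 2 e], then for small [s] the increment of [F] is at least [(M + e) * s], which
   contradicts [HM]. *)
pose e := (a x y - M) / 2; have e0 : 0 < e by rewrite divr_gt0 // subr_gt0.
have [s [s0 st sd se]] : exists s, [/\ 0 < s, s <= t, s <= d & L * s <= e].
  exists (Order.min t (Order.min d (e / L))).
  rewrite !lt_min t0 d0 divr_gt0 //; split=> //.
  - by rewrite ge_min lexx.
  - by rewrite !ge_min lexx orbT.
  - by rewrite mulrC -ler_pdivlMr // !ge_min lexx !orbT.
have st' : 0 < s <= t by rewrite s0.
have := HM s st' x y xr yr; apply/negP; rewrite -ltNge.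
have := @increment_bound R (F^~ y) (a^~ y) x (x + s) (a x y) e.
have -> : x + s - x = s by ring.
have xs u : x <= u <= x + s -> `|u - x| <= s by rewrite ler_distl; lra.
rewrite ler_norml => H.
have /andP[H1 _] : - (e * s) <= F (x + s) y - F x y - a x y * s <= e * s.
  apply: H; first by rewrite lerDl ltW.
    move=> u /xs us; have ut : `|u - x0| <= r + t by apply: tri xr _; exact: le_trans st.
    by have [] := dF u y (in3 _ _ ut) (in3 _ _ (wide _ _ yr)).
  move=> u /xs us; have [|Ha _] := HL u y (le_trans us sd).
    by rewrite subrr normr0 ltW.
  apply: (le_trans Ha); rewrite subrr normr0 addr0; apply: le_trans se.
  by rewrite ler_pM2l.
have es0 : 0 < e * s by rewrite mulr_gt0.
have E : a x y * s = M * s + 2 * (e * s) by rewrite /e; field.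
by clear - H1 es0 E; lra.
Qed.

End Potential.

(** * Complex differentiability *)

Import ComplexField.Normc.
Local Open Scope complex_scope.

(** * The real-valued modulus *)

Section Modulus.
Variable R : realType.
Implicit Types (z w : R[i]).

(** The norm of [R[i]] takes its values in [R[i]]; estimates are made with [normc], whose values lie
    in the ordered field [R]. *)
Lemma modulusE z : `|z| = (normc z)%:C.
Proof. by []. Qed.

Lemma modulus_ge0 z : 0 <= normc z.
Proof. by case: z => a b; exact: sqrtr_ge0. Qed.

Lemma modulusD z w : normc (z + w) <= normc z + normc w.
Proof. exact: le_normcD. Qed.

Lemma modulusN z : normc (- z) = normc z.
Proof. exact: normcN. Qed.

Lemma modulusB z w : normc (z - w) <= normc z + normc w.
Proof. by rewrite -(modulusN w); exact: modulusD. Qed.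

Lemma modulusC z w : normc (z - w) = normc (w - z).
Proof. by rewrite -modulusN opprB. Qed.

Lemma modulusX z n : normc (z ^+ n) = normc z ^+ n.
Proof.
by elim: n => [|n IH]; rewrite ?expr0 ?normc1 // !exprS normcM IH.
Qed.

Lemma modulus_eq0 z : (normc z == 0) = (z == 0).
Proof. by apply/eqP/eqP => [/eq0_normc //|->]; exact: normc0. Qed.

Lemma modulus_gt0 z : (0 < normc z) = (z != 0).
Proof. by rewrite lt0r modulus_eq0 modulus_ge0 andbT. Qed.

Lemma modulus_sqr z : normc z ^+ 2 = complex.Re z ^+ 2 + complex.Im z ^+ 2.
Proof. by case: z => a b /=; rewrite sqr_sqrtr // addr_ge0 ?sqr_ge0. Qed.

Lemma modulus_real (x : R) : normc x%:C = `|x|.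
Proof. by rewrite /= expr0n addr0 sqrtr_sqr. Qed.

Lemma Re_le_modulus z : `|complex.Re z| <= normc z.
Proof.
rewrite -ler_sqr ?nnegrE ?modulus_ge0 // modulus_sqr real_normK ?num_real //.
by rewrite lerDl sqr_ge0.
Qed.

Lemma Im_le_modulus z : `|complex.Im z| <= normc z.
Proof.
rewrite -ler_sqr ?nnegrE ?modulus_ge0 // modulus_sqr real_normK ?num_real //.
by rewrite lerDr sqr_ge0.
Qed.

Lemma modulus_le_ReIm z : normc z <= `|complex.Re z| + `|complex.Im z|.
Proof.
rewrite -ler_sqr ?nnegrE ?modulus_ge0 ?addr_ge0 // modulus_sqr sqrrD.
rewrite !real_normK ?num_real // -addrA [X in _ <= _ + X]addrC addrA lerDl.
by rewrite mulrn_wge0 // mulr_ge0.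
Qed.

Lemma ReD z w : complex.Re (z + w) = complex.Re z + complex.Re w.
Proof. by case: z; case: w. Qed.

Lemma ImD z w : complex.Im (z + w) = complex.Im z + complex.Im w.
Proof. by case: z; case: w. Qed.

Lemma ReN z : complex.Re (- z) = - complex.Re z.
Proof. by case: z. Qed.

Lemma ImN z : complex.Im (- z) = - complex.Im z.
Proof. by case: z. Qed.

Lemma ReM z w : complex.Re (z * w) =
  complex.Re z * complex.Re w - complex.Im z * complex.Im w.
Proof. by case: z; case: w. Qed.

Lemma ImM z w : complex.Im (z * w) =
  complex.Re z * complex.Im w + complex.Im z * complex.Re w.
Proof. by case: z => a b; case: w => c d /=; ring. Qed.

End Modulus.

(** * Calculus of complex differentiability through slope functions *)

Section ComplexDifferentiability.
Variable R : realType.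
Implicit Types (f g q : R[i] -> R[i]) (s z w : R[i]).

Definition ccontinuous q s := forall e : R, 0 < e ->
  exists2 d, 0 < d & forall z, normc (z - s) <= d -> normc (q z - q s) <= e.

(* Caratheodory's form of differentiability. *)
Definition cdifferentiable f s := exists q (r : R),
  [/\ 0 < r, ccontinuous q s &
      forall z, normc (z - s) <= r -> f z = f s + (z - s) * q z].

Lemma ccontinuous_cst w s : ccontinuous (fun=> w) s.
Proof. by move=> e e0; exists 1 => // z _; rewrite subrr normc0 ltW. Qed.

Lemma ccontinuous_id s : ccontinuous id s.
Proof. by move=> e e0; exists e. Qed.

Lemma ccontinuous_local f g s r : 0 < r -> (forall z, normc (z - s) <= r -> f z = g z) ->
  ccontinuous f s -> ccontinuous g s.
Proof.
move=> r0 fg cf e e0; have [d d0 Hd] := cf _ e0.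
exists (Order.min d r); first by rewrite lt_min d0.
move=> z; rewrite le_min => /andP[zd zr].
by rewrite -!fg ?subrr ?normc0 ?(ltW r0) // Hd.
Qed.

Lemma ccontinuousD f g s : ccontinuous f s -> ccontinuous g s ->
  ccontinuous (fun z => f z + g z) s.
Proof.
move=> cf cg e e0; have e20 : 0 < e / 2 by rewrite divr_gt0.
have [d d0 Hd] := cf _ e20; have [d' d'0 Hd'] := cg _ e20.
exists (Order.min d d'); first by rewrite lt_min d0.
move=> z; rewrite le_min => /andP[/Hd H1 /Hd' H2].
have -> : f z + g z - (f s + g s) = (f z - f s) + (g z - g s) by ring.
by apply: (le_trans (modulusD _ _)); lra.
Qed.

Lemma ccontinuousM f g s : ccontinuous f s -> ccontinuous g s ->
  ccontinuous (fun z => f z * g z) s.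
Proof.
move=> cf cg e e0.
pose F := normc (f s) + 1; pose G := normc (g s) + 1.
have F0 : 0 < F by rewrite ltr_wpDl // modulus_ge0.
have G0 : 0 < G by rewrite ltr_wpDl // modulus_ge0.
have [|d d0 Hd] := cf (e / 2 / G); first by rewrite !divr_gt0.
have [|d' d'0 Hd'] := cg (Order.min 1 (e / 2 / F)).
  by rewrite lt_min ltr01 !divr_gt0.
exists (Order.min d d'); first by rewrite lt_min d0.
move=> z; rewrite le_min => /andP[/Hd H1 /Hd']; rewrite le_min => /andP[H2 H3].
have -> : f z * g z - f s * g s = (f z - f s) * g z + f s * (g z - g s) by ring.
apply: (le_trans (modulusD _ _)); rewrite !normcM.
have gz : normc (g z) <= G.
  have -> : g z = (g z - g s) + g s by ring.
  by apply: (le_trans (modulusD _ _)); rewrite addrC lerD2l.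
have fs : normc (f s) <= F by rewrite lerDl.
have A1 : normc (f z - f s) * normc (g z) <= e / 2.
  rewrite -[leRHS](divfK (lt0r_neq0 G0)).
  by apply: ler_pM => //; exact: modulus_ge0.
have A2 : normc (f s) * normc (g z - g s) <= e / 2.
  rewrite -[leRHS](divfK (lt0r_neq0 F0)) mulrC.
  by apply: ler_pM => //; exact: modulus_ge0.
lra.
Qed.

Lemma ccontinuousV f s : f s != 0 -> ccontinuous f s ->
  ccontinuous (fun z => (f z)^-1) s.
Proof.
move=> f0 cf e e0; pose F := normc (f s).
have F0 : 0 < F by rewrite modulus_gt0.
have [|d d0 Hd] := cf (Order.min (F / 2) (e * (F * F / 2))).
  by rewrite lt_min (divr_gt0 F0) //= mulr_gt0 // divr_gt0 // mulr_gt0.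
exists d => // z /Hd; rewrite le_min => /andP[H1 H2].
have fz : F / 2 <= normc (f z).
  have : F <= normc (f z) + F / 2.
    rewrite /F; have {1}-> : f s = f z - (f z - f s) by ring.
    by apply: (le_trans (modulusB _ _)); rewrite lerD2l.
  by lra.
have fz0 : 0 < normc (f z) by apply: lt_le_trans fz; rewrite divr_gt0.
have fzn : f z != 0 by rewrite -modulus_gt0.
have -> : (f z)^-1 - (f s)^-1 = - (f z - f s) / (f z * f s) by field; rewrite f0 fzn.
rewrite normcM modulusN normcV normcM -/F ler_pdivrMr ?mulr_gt0 //.
apply: (le_trans H2); rewrite ler_pM2l // mulrAC ler_pM2r //.
Qed.

Lemma ccontinuousX f s n : ccontinuous f s -> ccontinuous (fun z => f z ^+ n) s.
Proof.
move=> cf; elim: n => [|n IH]; first exact: ccontinuous_cst.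
rewrite (_ : (fun z => _) = fun z => f z * f z ^+ n); first exact: ccontinuousM.
by apply/funext => z; rewrite exprS.
Qed.

Lemma cdifferentiable_continuous f s : cdifferentiable f s -> ccontinuous f s.
Proof.
move=> [q [r [r0 cq fE]]].
apply: (@ccontinuous_local (fun z => f s + (z - s) * q z) _ _ _ r0).
  by move=> z zr; rewrite (fE z zr).
apply: ccontinuousD; first exact: ccontinuous_cst.
apply: ccontinuousM => //; apply: ccontinuousD; first exact: ccontinuous_id.
exact: ccontinuous_cst.
Qed.

Lemma cdifferentiable_cst w s : cdifferentiable (fun=> w) s.
Proof.
exists (fun=> 0), 1; split => //; first exact: ccontinuous_cst.
by move=> z _; rewrite mulr0 addr0.
Qed.

Lemma cdifferentiable_id s : cdifferentiable id s.
Proof.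
exists (fun=> 1), 1; split => //; first exact: ccontinuous_cst.
by move=> z _; rewrite mulr1 addrC subrK.
Qed.

Lemma cdifferentiableD f g s : cdifferentiable f s -> cdifferentiable g s ->
  cdifferentiable (fun z => f z + g z) s.
Proof.
move=> [q [r [r0 cq fE]]] [q' [r' [r'0 cq' gE]]].
exists (fun z => q z + q' z), (Order.min r r'); split.
- by rewrite lt_min r0.
- exact: ccontinuousD.
- by move=> z; rewrite le_min => /andP[/fE -> /gE ->]; ring.
Qed.

Lemma cdifferentiableM f g s : cdifferentiable f s -> cdifferentiable g s ->
  cdifferentiable (fun z => f z * g z) s.
Proof.
move=> df dg; have cf := cdifferentiable_continuous df.
case: df dg => [q [r [r0 cq fE]]] [q' [r' [r'0 cq' gE]]].
exists (fun z => f z * q' z + q z * g s), (Order.min r r'); split.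
- by rewrite lt_min r0.
- apply: ccontinuousD; first exact: ccontinuousM.
  by apply: ccontinuousM => //; exact: ccontinuous_cst.
- by move=> z; rewrite le_min => /andP[/fE -> /gE ->]; ring.
Qed.

Lemma cdifferentiableX f s n : cdifferentiable f s ->
  cdifferentiable (fun z => f z ^+ n) s.
Proof.
move=> df; elim: n => [|n IH]; first exact: cdifferentiable_cst.
have [q [r [r0 cq fE]]] := cdifferentiableM df IH.
by exists q, r; split => // z /fE; rewrite -!exprS.
Qed.

Lemma cdifferentiableB f g s : cdifferentiable f s -> cdifferentiable g s ->
  cdifferentiable (fun z => f z - g z) s.
Proof.
move=> df dg; have [q [r [r0 cq E]]] :=
  cdifferentiableD df (cdifferentiableM (cdifferentiable_cst (-1) s) dg).
by exists q, r; split => // z /E; rewrite !mulN1r.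
Qed.

Lemma cdifferentiableV f s : f s != 0 -> cdifferentiable f s ->
  cdifferentiable (fun z => (f z)^-1) s.
Proof.
move=> f0 df; have cf := cdifferentiable_continuous df.
have F0 : 0 < normc (f s) / 2 by rewrite divr_gt0 // modulus_gt0.
have [d d0 Hd] := cf _ F0; case: df => [q [r [r0 cq fE]]].
exists (fun z => - q z * ((f z)^-1 * (f s)^-1)), (Order.min r d); split.
- by rewrite lt_min r0.
- apply: ccontinuousM.
    rewrite (_ : (fun z => _) = fun z => -1 * q z).
      by apply: ccontinuousM => //; exact: ccontinuous_cst.
    by apply/funext => z; rewrite mulN1r.
  apply: ccontinuousM; last exact: ccontinuous_cst.
  exact: ccontinuousV.
move=> z; rewrite le_min => /andP[zr /Hd zd].
have fz : f z != 0.
  apply/eqP => fz; move: zd; rewrite fz sub0r modulusN; lra.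
have E := fE z zr.
have -> : (z - s) * (- q z * ((f z)^-1 * (f s)^-1)) =
   - ((z - s) * q z) * ((f z)^-1 * (f s)^-1) by ring.
have -> : (z - s) * q z = f z - f s by rewrite E; ring.
by field; rewrite f0 fz.
Qed.

Lemma derivable_cdifferentiable (f : Cplx R -> Cplx R) (s : Cplx R) :
  derivable f s 1 -> cdifferentiable f s.
Proof.
move=> /cvg_ex [D /= HD].
(* The difference quotient, completed by the derivative [D] at [s]. The factorization holds
   everywhere, so the radius 1 is arbitrary. *)
exists (fun z => if z == s then D else (f z - f s) / (z - s)), 1; split => //.
  move=> e e0; have /cvgrPdist_le /(_ e%:C) := HD.
  rewrite ltcR => /(_ e0) /nbhs_ballP [d /= d0 Hd].
  have [d' d'0 dE] : exists2 d' : R, 0 < d' & d = d'%:C.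
    move: d0; case: (d) => a b; rewrite ltcE /= => /andP[/eqP -> a0].
    by exists a.
  exists (d' / 2); first by rewrite divr_gt0.
  move=> z zd; rewrite eqxx; case: eqVneq => [_|zs].
    by rewrite subrr normc0 ltW.
  have := Hd (z - s); rewrite /ball /= sub0r normrN dE => H.
  have zs' : z - s != 0 by rewrite subr_eq0.
  have ds : `|z - s| < d'%:C by rewrite modulusE ltcR; lra.
  have := H ds zs'; rewrite modulusE lecR.
  rewrite (_ : (z - s)%:A + s = z); last by rewrite [_%:A]mulr1 subrK.
  by rewrite modulusC [_ *: _]mulrC.
move=> z _; case: eqVneq => [->|zs]; first by rewrite subrr mul0r addr0.
by rewrite mulrC divfK ?subr_eq0 // addrC subrK.
Qed.

End ComplexDifferentiability.

(** * Maximum modulus principle and Schwarz lemma *)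

Section MaximumModulus.
Variable R : realType.
Implicit Types (f : R[i] -> R[i]) (p z w : R[i]).

(* Squares rather than discs: the estimates come from [cauchy_riemann_max]. *)
Definition sqnorm z := Order.max `|complex.Re z| `|complex.Im z|.

Lemma sqnorm_le_modulus z : sqnorm z <= normc z.
Proof. by rewrite ge_max Re_le_modulus Im_le_modulus. Qed.

Lemma modulus_le_sqnorm z : normc z <= 2 * sqnorm z.
Proof.
apply: (le_trans (modulus_le_ReIm _)).
have : `|complex.Re z| <= sqnorm z by rewrite le_max lexx.
have : `|complex.Im z| <= sqnorm z by rewrite le_max lexx orbT.
lra.
Qed.

Lemma cdifferentiable_cauchy_riemann f (x y : R) : cdifferentiable f (x +i* y) ->
  cauchy_riemann_at (fun x y => complex.Re (f (x +i* y)))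
                    (fun x y => complex.Im (f (x +i* y))) x y.
Proof.
move=> [q [r [r0 cq fE]]]; set s := x +i* y in cq fE *.
exists (complex.Re (q s)), (complex.Im (q s)) => e e0.
have [d d0 Hd] := cq _ e0.
exists (Order.min r d / 2); first by rewrite divr_gt0 // lt_min r0.
move=> h k; rewrite !ler_pdivlMr // !le_min => /andP[hr hd] /andP[kr kd].
pose z := h +i* k.
have zle : normc z <= `|h| + `|k| := modulus_le_ReIm z.
have sz : (x + h) +i* (y + k) - s = z.
  by apply/eqP; rewrite eq_complex /=; apply/andP; split; apply/eqP; ring.
have H1 : normc (q ((x + h) +i* (y + k)) - q s) <= e by apply: Hd; rewrite sz; lra.
have E : f ((x + h) +i* (y + k)) - (f s + q s * z) =
    z * (q ((x + h) +i* (y + k)) - q s).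
  by rewrite fE ?sz; [ring|lra].
have H2 : normc (f ((x + h) +i* (y + k)) - (f s + q s * z)) <= e * (`|h| + `|k|).
  rewrite E normcM mulrC; apply: ler_pM => //; exact: modulus_ge0.
have := Re_le_modulus (f ((x + h) +i* (y + k)) - (f s + q s * z)).
have := Im_le_modulus (f ((x + h) +i* (y + k)) - (f s + q s * z)).
rewrite !(ReD, ImD, ReN, ImN, ReM, ImM) /= => HI HR; split.
  by apply: le_trans H2; apply: le_trans HR; rewrite addrA.
apply: le_trans H2; apply: le_trans HI.
by rewrite -addrA [_ * h + _]addrC.
Qed.

(** The maximum principle for real parts is applied to [conjc (f w) * f]: at [w] its real part is
    the squared modulus of [f w], and on the ring it is at most [normc (f w) * M]. *)
Theorem maximum_modulus f p (R1 R2 M : R) : 0 <= R1 < R2 ->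
  (forall z, sqnorm (z - p) <= R2 -> cdifferentiable f z) ->
  (forall z, R1 <= sqnorm (z - p) <= R2 -> normc (f z) <= M) ->
  forall z, sqnorm (z - p) <= R1 -> normc (f z) <= M.
Proof.
move=> R12 df fM w wR.
(* In this case only [0 <= M] is at stake, which the ring point [p + R1] provides. *)
have [->|fw] := eqVneq (f w) 0.
  have := fM (p + R1%:C); rewrite (addrC p) addrK => H.
  have sR : sqnorm R1%:C = R1.
    by case/andP: R12 => R10 _; rewrite /sqnorm /= normr0 ger0_norm // max_l.
  rewrite normc0; apply: le_trans (modulus_ge0 _) (H _).
  by rewrite sR lexx ltW //; case/andP: R12.
pose v := conjc (f w); pose g z := v * f z.
have vM : normc v = normc (f w) by rewrite /v; case: (f w) => a b /=; rewrite sqrrN.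
have sq (x y : R) : sqnorm (x +i* y - p) = Order.max `|x - complex.Re p| `|y - complex.Im p|.
  by rewrite /sqnorm ReD ImD ReN ImN.
have max := @cauchy_riemann_max R (fun x y => complex.Re (g (x +i* y)))
  (fun x y => complex.Im (g (x +i* y))) (complex.Re p) (complex.Im p) R1 R2
  (normc (f w) * M) R12.
have : complex.Re (g w) <= normc (f w) * M.
  have {1}-> : w = complex.Re w +i* complex.Im w by case: (w).
  move: wR; rewrite /sqnorm ge_max !(ReD, ImD, ReN, ImN) => /andP[w1 w2].
  apply: max => // x y x1 y1.
    apply: cdifferentiable_cauchy_riemann; apply: cdifferentiableM.
      exact: cdifferentiable_cst.
    by apply: df; rewrite sq ge_max x1.
  move=> xy; apply: (le_trans (ler_norm _)); apply: (le_trans (Re_le_modulus _)).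
  rewrite /g normcM vM ler_wpM2l ?modulus_ge0 // fM //.
  by rewrite sq ge_max le_max x1 y1 !andbT; apply/orP.
have -> : complex.Re (g w) = normc (f w) * normc (f w).
  by rewrite -expr2 modulus_sqr /g /v; case: (f w) => a b /=; ring.
by rewrite ler_pM2l // modulus_gt0.
Qed.

(** If [y < x], the powers of [x / y] are bounded by [M / x], against Bernoulli's inequality. This
    is the passage to the limit in the Schwarz lemma below. *)
Lemma le_of_powers (x y M : R) : 0 <= y ->
  (forall n, x ^+ n.+2 <= M * y ^+ n.+1) -> x <= y.
Proof.
move=> y0 H; rewrite leNgt; apply/negP => yx.
have x0 : 0 < x by exact: le_lt_trans yx.
have [y00|yn0] := eqVneq y 0.
  have := H 0%N; rewrite y00 expr0n /= mulr0 leNgt exprn_gt0 //.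
have y0' : 0 < y by rewrite lt0r yn0.
pose t := x / y - 1.
have t0 : 0 < t by rewrite subr_gt0 ltr_pdivlMr // mul1r.
have bern n : 1 + n%:R * t <= (x / y) ^+ n.
  have -> : x / y = 1 + t by rewrite /t; ring.
  elim: n => [|n IH]; first by rewrite mul0r addr0 expr0.
  rewrite exprS -natr1; have n0 : 0 <= n%:R * t by rewrite mulr_ge0 // ltW.
  have : (1 + t) * (1 + n%:R * t) <= (1 + t) * (1 + t) ^+ n.
    by rewrite ler_pM2l // ltr_wpDl.
  have := mulr_ge0 n0 (ltW t0); lra.
have HM n : (x / y) ^+ n.+1 <= M / x.
  rewrite expr_div_n ler_pdivlMr // mulrAC ler_pdivrMr ?exprn_gt0 //.
  by rewrite -exprSr.
pose N := Num.bound (`|M / x| / t).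
have := le_trans (bern _) (HM N).
have : `|M / x| / t < N%:R by apply: archi_boundP; rewrite divr_ge0 // ltW.
rewrite ltr_pdivrMr // -natr1 => h1 h2.
by have := ler_norm (M / x); lra.
Qed.

(* The quotient [f ^ n.+2 / (z - p) ^ n.+1] is holomorphic also at the zero [p]
   of [f]; letting [n] grow makes a removable-singularity theorem unnecessary. *)
Lemma schwarz f p (R1 R2 M : R) : 0 < R1 < R2 ->
  (forall z, sqnorm (z - p) <= R2 -> cdifferentiable f z) -> f p = 0 ->
  (forall z, R1 <= sqnorm (z - p) <= R2 -> normc (f z) <= M) ->
  forall z, sqnorm (z - p) <= R1 -> normc (f z) <= M / R1 * normc (z - p).
Proof.
move=> /andP[R10 R12] df fp fM w wR.
have M0 : 0 <= M.
  have := fM (p + R1%:C); rewrite (addrC p) addrK => H.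
  have sR : sqnorm R1%:C = R1.
    by rewrite /sqnorm /= normr0 gtr0_norm // max_l // ltW.
  by apply: le_trans (modulus_ge0 _) (H _); rewrite sR lexx ltW.
have [->|wp] := eqVneq w p; first by rewrite fp subrr normc0 mulr0.
have wp0 : 0 < normc (w - p) by rewrite modulus_gt0 subr_eq0.
apply: (@le_of_powers _ _ M); first by rewrite mulr_ge0 ?modulus_ge0 // divr_ge0 // ltW.
move=> n; pose g z := f z ^+ n.+2 * ((z - p)^-1) ^+ n.+1.
have gM z : normc (g z) = normc (f z) ^+ n.+2 / normc (z - p) ^+ n.+1.
  by rewrite /g normcM !modulusX normcV exprVn.
have : normc (g w) <= M * (M / R1) ^+ n.+1.
  apply: (@maximum_modulus g p R1 R2) wR; first by rewrite ltW.
  - move=> z zR; have [->|zp] := eqVneq z p.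
      have [|q [r [r0 cq fE]]] := df p.
        by rewrite subrr /sqnorm /= normr0 maxxx ltW // (lt_trans R10).
      (* Near [p], [f z = (z - p) * q z] gives [g z = (z - p) * q z ^+ n.+2]; at [p] itself the
         convention that the inverse of 0 is 0 makes [g p = 0]. *)
      exists (fun z => q z ^+ n.+2), r; split => //; first exact: ccontinuousX.
      move=> z' z'r; rewrite /g (fE _ z'r) fp subrr invr0 !expr0n /= mulr0 !add0r.
      have [->|zp'] := eqVneq z' p; first by rewrite subrr invr0 expr0n /= mulr0 mul0r.
      have zp0 : z' - p != 0 by rewrite subr_eq0.
      rewrite exprMn exprVn [(z' - p) ^+ n.+2]exprS.
      by field; rewrite expf_neq0.
    apply: cdifferentiableM; first exact/cdifferentiableX/df.
    apply: cdifferentiableX; apply: cdifferentiableV; first by rewrite subr_eq0.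
    by apply: cdifferentiableB; [exact: cdifferentiable_id|exact: cdifferentiable_cst].
  move=> z zR; rewrite gM expr_div_n mulrA -exprS.
  have zp : R1 <= normc (z - p).
    by case/andP: zR => zR _; exact: le_trans (sqnorm_le_modulus _).
  apply: ler_pM; rewrite ?invr_ge0 ?exprn_ge0 ?modulus_ge0 //.
    by rewrite lerXn2r ?nnegrE ?modulus_ge0 // fM.
  rewrite lef_pV2 ?posrE ?exprn_gt0 //; last exact: lt_le_trans zp.
  by rewrite lerXn2r ?nnegrE ?(ltW R10) // modulus_ge0.
rewrite gM ler_pdivrMr ?exprn_gt0 // => H.
by rewrite exprMn mulrA.
Qed.

End MaximumModulus.

(** * Injectivity of semigroups *)

Section Semigroup.
Variable R : realType.
Implicit Types (f : R[i] -> R[i]) (a b p s z w : R[i]).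

Lemma half_plane_square p z : sqnorm (z - p) <= 3 / 4 * complex.Re p ->
  complex.Re p / 4 <= complex.Re z.
Proof.
rewrite ge_max ReD ReN => /andP[+ _]; rewrite ler_norml => /andP[]; lra.
Qed.

(** The identity showing that the Cayley quotient [(z - w) / (z + conjc w)] maps the right
    half-plane into the unit disc. *)
Lemma half_plane_distance z w :
  normc (z + conjc w) ^+ 2 = normc (z - w) ^+ 2 + 4 * (complex.Re z * complex.Re w).
Proof.
by rewrite !modulus_sqr; case: z => x y; case: w => u v /=; ring.
Qed.

(* Schwarz--Pick estimate at [a], with a non-optimal constant. *)
Lemma half_plane_contraction (f : Cplx R -> Cplx R) a s : analytic_self_map f ->
  0 < complex.Re a -> normc (s - a) <= complex.Re a / 4 ->
  3 / 16 * complex.Re (f a) <= complex.Re (f s) /\ normc (f s) <= 3 * normc (f a).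
Proof.
move=> [df f0] a0 sa.
have dz z : sqnorm (z - a) <= 3 / 4 * complex.Re a -> 0 < complex.Re z.
  by move=> /half_plane_square; lra.
pose w := f a; have w0 : 0 < complex.Re w by exact: f0.
(* The Cayley transform sending [f a] to 0, composed with [f]. *)
pose m z := (f z - w) * (f z + conjc w)^-1.
have den z : 0 < complex.Re z -> 0 < normc (f z + conjc w).
  move=> z0; rewrite modulus_gt0; apply/eqP => /(congr1 (@complex.Re R)).
  rewrite ReD; have := f0 z z0; rewrite /half_plane /=; move: w0; case: (w) => x y /=; lra.
have m1 z : 0 < complex.Re z -> normc (m z) <= 1.
  move=> z0; rewrite normcM normcV ler_pdivrMr ?den // mul1r.
  rewrite -ler_sqr ?nnegrE ?modulus_ge0 // half_plane_distance.
  by rewrite lerDl mulr_ge0 // mulr_ge0 // ltW //; exact: f0.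
(* As [s] is within [complex.Re a / 4] of [a], this bounds the modulus of [m s] by [1 / 2]. *)
have H : normc (m s) <= 1 / (complex.Re a / 2) * normc (s - a).
  apply: (@schwarz R m a (complex.Re a / 2) (3 / 4 * complex.Re a)).
  - by apply/andP; split; lra.
  - move=> z /dz z0.
    have dfz : cdifferentiable f z by apply: derivable_cdifferentiable; exact: df.
    apply: cdifferentiableM.
      by apply: cdifferentiableB => //; exact: cdifferentiable_cst.
    apply: cdifferentiableV; first by rewrite -modulus_gt0 den.
    by apply: cdifferentiableD => //; exact: cdifferentiable_cst.
  - by rewrite /m subrr mul0r.
  - by move=> z /andP[_ /dz]; exact: m1.
  - by apply: le_trans (sqnorm_le_modulus _) _; lra.
have s0 : 0 < complex.Re s.
  by apply: dz; apply: le_trans (sqnorm_le_modulus _) _; lra.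
have ms : normc (f s - w) <= normc (f s + conjc w) / 2.
  have : normc (m s) <= 1 / 2.
    apply: (le_trans H); rewrite div1r mulrC ler_pdivrMr; lra.
  by rewrite normcM normcV ler_pdivrMr ?den // mulrC mul1r.
have fs0 : 0 < complex.Re (f s) by exact: f0.
have E := half_plane_distance (f s) w.
have sq : normc (f s - w) ^+ 2 <= (normc (f s + conjc w) / 2) ^+ 2.
  by rewrite lerXn2r ?nnegrE ?divr_ge0 ?modulus_ge0.
have sum : complex.Re (f s) + complex.Re w <= normc (f s + conjc w).
  have := Re_le_modulus (f s + conjc w); rewrite ReD.
  by have := ler_norm (complex.Re (f s) + complex.Re (conjc w)); case: (w) => x y /=; lra.
have sum2 : (complex.Re (f s) + complex.Re w) ^+ 2 <= normc (f s + conjc w) ^+ 2.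
  by rewrite lerXn2r ?nnegrE ?modulus_ge0 // addr_ge0 // ltW.
(* For [S] the squared modulus of [f s + conjc w], [E] and [sq] give [3 / 4 * S <= 4 * (complex.Re
   (f s) * complex.Re w)], while [S] is at least the square of [complex.Re w]; one factor
   [complex.Re w] is then cancelled. *)
split.
  rewrite -(ler_pM2r w0); have := sqr_ge0 (complex.Re (f s)).
  have := mulr_gt0 fs0 w0; lra.
(* Together with [ms] this yields [normc (f s - w) <= 2 * complex.Re w], hence the factor 3. *)
have tri : normc (f s + conjc w) <= normc (f s - w) + 2 * complex.Re w.
  have -> : f s + conjc w = (f s - w) + (w + conjc w) by ring.
  apply: (le_trans (modulusD _ _)); rewrite lerD2l.
  apply: (le_trans (modulus_le_ReIm _)); move: w0; case: (w) => x y /= x0.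
  by rewrite subrr normr0 addr0 ger0_norm; lra.
have := modulusD (f s - w) w; rewrite subrK.
have := le_trans (ler_norm _) (Re_le_modulus w); rewrite -/w; lra.
Qed.

Lemma rectangle_compact (m M : R) :
  compact ([set z | m <= complex.Re z <= M /\ - M <= complex.Im z <= M] : set (Cplx R)).
Proof.
pose S := `[m, M] `*` `[- M, M].
have cS : compact S by apply: compact_setX; exact: segment_compact.
pose c (q : R * R) : Cplx R := q.1 +i* q.2.
rewrite (_ : [set z | _] = c @` S).
  apply: continuous_compact => //; apply: continuous_in_subspaceT => -[x y] _.
  apply/cvgrPdist_le => e; case: e => e1 e2; rewrite ltcE /= => /andP[/eqP -> e0].
  have e20 : 0 < e1 / 2 by rewrite divr_gt0.
  exists (ball x (e1 / 2), ball y (e1 / 2)); first by split; apply: nbhsx_ballx.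
  move=> [x' y'] /= [xd yd].
  rewrite -[leLHS]/((normc (c (x, y) - c (x', y')))%:C) lecR.
  apply: (le_trans (modulus_le_ReIm _)) => /=.
  have : `|x - x'| < e1 / 2 by [].
  have : `|y - y'| < e1 / 2 by [].
  lra.
apply/seteqP; split=> [[x y] /= [xx yy]|_ [[x y] /= [xx yy] <-]].
  by exists (x, y) => //; split; rewrite /= in_itv.
by move: xx yy; rewrite /= !in_itv.
Qed.

Variable Phi : R -> Cplx R -> Cplx R.
Hypothesis hPhi : continuous_semigroup Phi.

(** The continuity hypothesis is applied to a compact rectangle containing all [z] with
    [m <= complex.Re z] and [normc z <= M]. *)
Lemma semigroup_near_id (m M e : R) : 0 < m -> 0 < e -> exists2 d, 0 < d &
  forall t z, 0 <= t <= d -> m <= complex.Re z -> normc z <= M ->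
    normc (Phi t z - z) <= e.
Proof.
move=> m0 e0; case: hPhi => _ P0 _ H.
pose K := [set z : Cplx R | m <= complex.Re z <= M /\ - M <= complex.Im z <= M].
have KH : K `<=` half_plane 0.
  by move=> z [/andP[mz _] _]; exact: lt_le_trans mz.
have {}H := H K (@rectangle_compact m M) KH.
pose P := [set h : Cplx R -> Cplx R | forall y, K y -> ball (Phi 0 y) e%:C (h y)].
have : nbhs (Phi 0 : {uniform` K -> Cplx R}) P.
  apply/uniform_nbhs; exists [set q | ball q.1 e%:C q.2]; split.
    by rewrite -entourage_ballE; exists e%:C; rewrite //= ltcR.
  by [].
move=> /H /nbhs_ballP [d /= d0 Hd].
exists (d / 2); first by rewrite divr_gt0.
move=> t z /andP[t0 td] mz zM.
have Kz : K z.
  have := Re_le_modulus z; have := Im_le_modulus z.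
  by rewrite /K /= !ler_norml; lra.
have z0 : 0 < complex.Re z by exact: lt_le_trans mz.
(* The right-hand limit says nothing at [t = 0], which is treated apart. *)
move: t0; rewrite le_eqVlt => /predU1P[<-|t0].
  by rewrite P0 // subrr normc0 ltW.
have := Hd t; rewrite /ball /= sub0r normrN gtr0_norm // => /(_ _ t0 z Kz).
rewrite P0 // modulusC => H1.
have : `|z - Phi t z| < e%:C by apply: H1; lra.
by rewrite modulusE ltcR => /ltW.
Qed.

(** For [h <= d] the point [Phi h a] stays close to [a]; applying [Phi (n * d)] to it and using the
    contraction estimate at [a] controls the orbit up to [(n + 1) * d]. The step [d] depends on [a]
    alone, so finitely many steps reach [T]. *)
Lemma orbit_bounded a (T : R) : 0 < complex.Re a -> exists m M : R,
  [/\ 0 < m & forall t, 0 <= t <= T -> m <= complex.Re (Phi t a) /\ normc (Phi t a) <= M].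
Proof.
move=> a0; have [maps P0 Pt _] := hPhi.
have a40 : 0 < complex.Re a / 4 by rewrite divr_gt0.
have [d d0 Hd] := @semigroup_near_id (complex.Re a) (normc a) _ a0 a40.
suff H n : exists m M : R, [/\ 0 < m & forall t, 0 <= t <= n%:R * d ->
    m <= complex.Re (Phi t a) /\ normc (Phi t a) <= M].
  have [m [M [m0 HmM]]] := H (Num.bound (`|T| / d)); exists m, M; split => //.
  move=> t /andP[t0 tT]; apply: HmM; rewrite t0 /=; apply: (le_trans tT).
  rewrite -ler_pdivrMr //; apply: ltW; apply: le_lt_trans (archi_boundP _).
    by rewrite ler_pM2r ?invr_gt0 // ler_norm.
  by rewrite divr_ge0 // ltW.
elim: n => [|n [m [M [m0 IH]]]].
  exists (complex.Re a), (normc a); split => // t.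
  rewrite mul0r => tt; have -> : t = 0 by apply/eqP; rewrite eq_le andbC.
  by rewrite P0.
pose w := Phi (n%:R * d) a.
have nd0 : 0 <= n%:R * d by rewrite mulr_ge0 // ltW.
have [df f0] := maps _ nd0.
have w0 : 0 < complex.Re w by exact: f0.
exists (Order.min m (3 / 16 * complex.Re w)), (Order.max M (3 * normc w)).
split; first by rewrite lt_min m0 mulr_gt0.
move=> t /andP[t0 tn]; have [tnd|tnd] := leP t (n%:R * d).
  have [|H1 H2] := IH t; first by rewrite t0.
  by split; [rewrite ge_min H1|rewrite le_max H2].
have [|H1 H2] := @half_plane_contraction (Phi (n%:R * d)) a
  (Phi (t - n%:R * d) a) (maps _ nd0) a0.
  apply: Hd => //; rewrite subr_ge0 (ltW tnd) /= lerBlDl.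
  by move: tn; rewrite -natr1 mulrDl mul1r.
rewrite Pt ?subr_ge0 ?(ltW tnd) // in H1 H2; rewrite addrC subrK in H1 H2.
by split; [rewrite ge_min H1 orbT|rewrite le_max H2 orbT].
Qed.

(** Let [f] be [Phi t - id] minus its value at [p]. It is small and vanishes at [p], so by Schwarz
    its modulus is at most a quarter of the distance to [p]; but [Phi t z = Phi t p] makes the
    modulus of [f z] equal to that distance. *)
Lemma semigroup_locally_injective (m M : R) : 0 < m -> exists2 d, 0 < d &
  forall t z w, 0 <= t <= d -> m <= complex.Re z -> normc z <= M ->
    m <= complex.Re w -> normc w <= M -> Phi t z = Phi t w -> z = w.
Proof.
move=> m0; have [maps _ _ _] := hPhi.
have m40 : 0 < m / 4 by rewrite divr_gt0.
have m160 : 0 < m / 16 by rewrite divr_gt0.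
(* The square of radius [3 / 4 * m] about [p] lies in [m / 4 <= complex.Re u], and its points have
   modulus at most [M + 2 * m]. *)
have [d d0 Hd] := @semigroup_near_id (m / 4) (M + 2 * m) _ m40 m160.
exists d => // t z p td mz zM mp pM tE.
have t0 : 0 <= t by case/andP: td.
have [df _] := maps _ t0.
pose f u := (Phi t u - u) - (Phi t p - p).
have near u : sqnorm (u - p) <= 3 / 4 * m -> m / 4 <= complex.Re u /\ normc (f u) <= m / 8.
  move=> up.
  have mu : m / 4 <= complex.Re u.
    by move: up; rewrite ge_max ReD ReN => /andP[+ _]; rewrite ler_norml => /andP[]; lra.
  split=> //; apply: (le_trans (modulusB _ _)).
  have A1 : normc (Phi t u - u) <= m / 16.
    apply: Hd => //; have -> : u = (u - p) + p by rewrite subrK.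
    apply: (le_trans (modulusD _ _)); have := modulus_le_sqnorm (u - p); lra.
  have A2 : normc (Phi t p - p) <= m / 16 by apply: Hd => //; lra.
  lra.
have fz : normc (f z) = normc (z - p).
  by rewrite /f tE -modulusN; congr normc; ring.
apply/eqP; rewrite -subr_eq0 -modulus_eq0 eq_le modulus_ge0 andbT.
have [zp|zp] := leP (sqnorm (z - p)) (m / 2).
  have : normc (f z) <= m / 8 / (m / 2) * normc (z - p).
    apply: (@schwarz R f p (m / 2) (3 / 4 * m)) => //.
    - by apply/andP; split; lra.
    - move=> u /near [mu _].
      have u0 : 0 < complex.Re u by lra.
      apply: cdifferentiableB; last exact: cdifferentiable_cst.
      apply: cdifferentiableB; last exact: cdifferentiable_id.
      by apply: derivable_cdifferentiable; exact: df.
    - by rewrite /f subrr.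
    - by move=> u /andP[_ /near []].
  have -> : m / 8 / (m / 2) = 1 / 4 by field; rewrite gt_eqF.
  by rewrite fz; lra.
have := sqnorm_le_modulus (z - p).
have A1 : normc (Phi t z - z) <= m / 16 by apply: Hd => //; lra.
have A2 : normc (Phi t p - p) <= m / 16 by apply: Hd => //; lra.
have := modulusB (Phi t z - z) (Phi t p - p); rewrite -/(f z) fz; lra.
Qed.

(** [Phi t] is an iterate of [Phi (t / n)], which for large [n] is injective on a region containing
    both orbits up to time [t]. *)
Theorem semigroup_injective (t : R) a b : 0 <= t ->
  0 < complex.Re a -> 0 < complex.Re b -> Phi t a = Phi t b -> a = b.
Proof.
move=> t0 a0 b0; have [_ P0 Pt _] := hPhi.
have [m1 [M1 [m10 H1]]] := orbit_bounded t a0.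
have [m2 [M2 [m20 H2]]] := orbit_bounded t b0.
pose m := Order.min m1 m2; pose M := Order.max M1 M2.
have m0 : 0 < m by rewrite lt_min m10.
have [d d0 Hd] := semigroup_locally_injective M m0.
pose n := (Num.bound (t / d)).+1.
have n0 : (0 : R) < n%:R by rewrite ltr0n.
have hd : 0 <= t / n%:R <= d.
  rewrite (divr_ge0 t0 (ltW n0)) /= ler_pdivrMr // mulrC -ler_pdivrMr //.
  apply: ltW; apply: lt_trans (archi_boundP _) _; first by rewrite divr_ge0 // ltW.
  by rewrite ltr_nat.
have orb k : (k <= n)%N -> 0 <= k%:R * (t / n%:R) <= t.
  move=> kn; have {3}-> : t = n%:R * (t / n%:R) by rewrite mulrC divfK // gt_eqF.
  by case/andP: hd => h0 _; rewrite mulr_ge0 //= ler_wpM2r // ler_nat.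
suff H k : (k <= n)%N -> Phi (k%:R * (t / n%:R)) a = Phi (k%:R * (t / n%:R)) b -> a = b.
  by have := H n (leqnn n); rewrite mulrC divfK // gt_eqF.
elim: k => [|k IH] kn; first by rewrite mul0r !P0.
have kn' := ltnW kn; have /andP[k0 kt] := orb _ kn'; have /andP[h0 _] := hd.
(* The sum is commuted so that the short-time map is outermost and can be cancelled. *)
rewrite -natr1 mulrDl mul1r addrC -!Pt // => E; apply: IH => //.
have [A1 A2] := H1 _ (orb _ kn'); have [B1 B2] := H2 _ (orb _ kn').
apply: Hd hd _ _ _ _ E; rewrite /m /M ?ge_min ?le_max ?A1 ?A2 ?B1 ?B2 ?orbT //.
Qed.

End Semigroup.

(** * Dirichlet series *)

Section ComplexExponential.
Variable R : realType.
Implicit Types (z w : Cplx R).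

Lemma cexpD z w : cexp (z + w) = cexp z * cexp w.
Proof.
case: z => a b; case: w => c d; rewrite /cexp /= expRD cosD sinD.
by apply/eqP; rewrite eq_complex /=; apply/andP; split; apply/eqP; ring.
Qed.

Lemma modulus_cexp z : normc (cexp z) = expR (complex.Re z).
Proof.
rewrite /cexp /= !exprMn -mulrDr cos2Dsin2 mulr1 sqrtr_sqr.
by rewrite gtr0_norm ?expR_gt0.
Qed.

Lemma cexp0 : cexp (0 : Cplx R) = 1.
Proof. by rewrite /cexp /= expR0 cos0 sin0 mulr1 mulr0. Qed.

Lemma cexp_2pi : cexp (0 +i* (- (pi *+ 2)) : Cplx R) = 1.
Proof. by rewrite /cexp /= expR0 cosN sinN cos2pi sin2pi oppr0 mulr1 mulr0. Qed.

(** An explicit bound on a square ring around 0. If the imaginary part is at least [1 / 2] in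
    absolute value, the imaginary part of the exponential is large; otherwise the real part is, and
    the modulus of the exponential stays away from 1. *)
Lemma cexp_sub1_lower_bound : exists2 c : R, 0 < c &
  forall z, 1 / 2 <= sqnorm z <= 1 -> c <= normc (cexp z - 1).
Proof.
have sh : 0 < sin (1 / 2 : R).
  by apply: sin2_gt0; apply/andP; split; lra.
pose e := expR (-1 : R); have e0 : 0 < e := expR_gt0 _.
pose c1 := 1 - expR (- (1 / 2) : R).
have c10 : 0 < c1 by rewrite subr_gt0 expR_lt1; lra.
exists (Order.min (1 / 2) (Order.min c1 (e * sin (1 / 2)))).
  by rewrite !lt_min c10 (mulr_gt0 e0 sh) divr_gt0.
move=> z /andP[z1 z2]; set c := Order.min _ _.
have ch : c <= 1 / 2 by rewrite ge_min lexx.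
have cc1 : c <= c1 by rewrite !ge_min lexx !orbT.
have ce : c <= e * sin (1 / 2) by rewrite !ge_min lexx !orbT.
have [vh|vh] := leP (1 / 2) `|complex.Im z|.
  apply: (le_trans ce); apply: le_trans (Im_le_modulus _).
  rewrite ImD ImN /= oppr0 addr0 normrM gtr0_norm ?expR_gt0 //.
  have v1 : `|complex.Im z| <= 1 by move: z2; rewrite ge_max => /andP[].
  have u1 : -1 <= complex.Re z.
    by move: z2; rewrite ge_max => /andP[+ _]; rewrite ler_norml => /andP[].
  apply: ler_pM; rewrite ?(ltW e0) ?(ltW sh) // ?ler_expR //.
  have S (t : R) : 1 / 2 <= t <= 1 -> sin (1 / 2) <= sin t.
    move=> /andP[t1 t2]; have := @pihalf_ge1 R => pi1.
    move: t1; rewrite le_eqVlt => /predU1P[<-//|t1].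
    by apply: ltW; rewrite ltr_sin // in_itv /=; apply/andP; split; lra.
  have [v0|v0] := leP 0 (complex.Im z).
    by apply: le_trans (ler_norm _); apply: S; rewrite -(ger0_norm v0) vh v1.
  rewrite -normrN -sinN; apply: le_trans (ler_norm _); apply: S.
  by rewrite -(ltr0_norm v0) vh v1.
have uh : 1 / 2 <= `|complex.Re z|.
  by move: z1; rewrite le_max => /orP[//|]; rewrite leNgt vh.
have L : `|expR (complex.Re z) - 1| <= normc (cexp z - 1).
  rewrite -modulus_cexp ler_norml; apply/andP; split.
    have := modulusD (1 - cexp z) (cexp z); rewrite subrK normc1 modulusC; lra.
  have := modulusD (cexp z - 1) 1; rewrite subrK normc1; lra.
apply: le_trans L; have [u0|u0] := leP 0 (complex.Re z).
  apply: (le_trans ch); apply: le_trans (ler_norm _).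
  by move: uh; rewrite ger0_norm // => uh; have := expR_ge1Dx (complex.Re z); lra.
apply: (le_trans cc1); rewrite -normrN; apply: le_trans (ler_norm _).
move: uh; rewrite ltr0_norm // => uh.
have : expR (complex.Re z) <= expR (- (1 / 2)) by rewrite ler_expR; lra.
rewrite /c1; lra.
Qed.

Lemma modulus_nat_cpow n z : normc (nat_cpow n z) = expR (ln n%:R * complex.Re z).
Proof. by rewrite /nat_cpow modulus_cexp ReM /= mul0r subr0. Qed.

End ComplexExponential.

(** * Coefficients and remainders of Dirichlet series *)

Section DirichletSeries.
Variables (R : realType) (a : nat -> Cplx R).
Implicit Types (s l : Cplx R).

Lemma dirichlet_sum_eps s l : dirichlet_sum a s l -> forall e : R, 0 < e ->
  exists N, forall n, (N <= n)%N -> normc (series (dirichlet_term a s) n - l) <= e.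
Proof.
move=> /cvgrPdist_le H e e0; have := H e%:C; rewrite ltcR => /(_ e0) [N _ HN].
exists N => n /HN /=; rewrite modulusC -lecR; exact.
Qed.

(** The terms of a convergent series are bounded: late ones are differences of two partial sums
    within 1 of the limit (hence the 2 in [C]), early ones are bounded by their sum. *)
Lemma dirichlet_coef_bound s l : dirichlet_sum a s l -> exists2 C : R, 0 <= C &
  forall k, normc (a k.+1) <= C * expR (complex.Re s * ln k.+1%:R).
Proof.
move=> /dirichlet_sum_eps /(_ 1 ltr01) [N HN].
pose u := dirichlet_term a s.
pose C : R := 2 + \sum_(k < N) normc (u k).
have S0 : 0 <= \sum_(k < N) normc (u k) by apply: sumr_ge0 => k _; exact: modulus_ge0.
have uC k : normc (u k) <= C.
  have [kN|Nk] := ltnP k N.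
    rewrite /C (bigD1 (Ordinal kN)) //=.
    have : 0 <= \sum_(i < N | i != Ordinal kN) normc (u i).
      by apply: sumr_ge0 => i _; exact: modulus_ge0.
    lra.
  have -> : u k = (series u k.+1 - l) - (series u k - l).
    by rewrite seriesEnat /= big_nat_recr //=; ring.
  apply: (le_trans (modulusB _ _)).
  by have := HN _ Nk; have := HN _ (leqW Nk); rewrite -/u /C; lra.
exists C; first by rewrite addr_ge0.
move=> k; have := uC k.
rewrite /u /dirichlet_term normcM modulus_nat_cpow ReN mulrN expRN.
by rewrite ler_pdivrMr ?expR_gt0 // [ln _ * _]mulrC.
Qed.

(** The coefficients grow at most like a power [t0] of the index, so for [t >= t0 + 2] the terms are
    dominated by a telescoping series. The first [K] terms end at index [K], hence the decay rate
    [K.+1]. *)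
Lemma dirichlet_remainder (theta : R) (phi : Cplx R -> Cplx R) K :
  (forall s, half_plane theta s -> dirichlet_sum a s (phi s)) -> (0 < K)%N ->
  exists C sigma : R, 0 <= C /\ forall s, sigma <= complex.Re s ->
    normc (phi s - series (dirichlet_term a s) K) <=
    C * expR (- (complex.Re s * ln K.+1%:R)).
Proof.
move=> conv K0; pose s0 : Cplx R := (theta + 1)%:C; pose t0 := theta + 1.
have hs0 : half_plane theta s0 by rewrite /half_plane /= ltrDl.
have [C C0 HC] := dirichlet_coef_bound (conv _ hs0).
pose B := C * expR ((t0 + 2) * ln K.+1%:R).
exists B, (t0 + 2); split; first by rewrite mulr_ge0 // expR_ge0.
move=> s hs; set t := complex.Re s in hs *.
pose D := C * expR (- ((t - t0 - 2) * ln K.+1%:R)).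
have D0 : 0 <= D by rewrite mulr_ge0 // expR_ge0.
have -> : B * expR (- (t * ln K.+1%:R)) = D.
  by rewrite /B /D -mulrA -expRD; congr (_ * expR _); ring.
pose u := dirichlet_term a s.
have uD k : (K <= k)%N -> normc (u k) <= D * (k%:R^-1 - k.+1%:R^-1).
  move=> Kk; have k0 : (0 < k)%N by exact: leq_trans Kk.
  have kp : (0 : R) < k%:R by rewrite ltr0n.
  have k1p : (0 : R) < k.+1%:R by rewrite ltr0n.
  rewrite /u /dirichlet_term normcM modulus_nat_cpow ReN -/t.
  have L : ln (K.+1%:R : R) <= ln k.+1%:R.
    by rewrite ler_ln ?posrE ?ltr0n // ler_nat.
  apply: (@le_trans _ _ (C * expR (t0 * ln k.+1%:R) * expR (ln k.+1%:R * - t))).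
    by rewrite ler_pM2r ?expR_gt0 //; exact: HC.
  (* A factor [k.+1 ^ (-2)] is set aside for summability; the remaining power is decreasing in [k]
     and is bounded by its value at [K]. *)
  have -> : C * expR (t0 * ln k.+1%:R) * expR (ln k.+1%:R * - t) =
      C * expR (- ((t - t0 - 2) * ln k.+1%:R)) * (k.+1%:R ^+ 2)^-1.
    have {4}-> : (k.+1%:R : R) = expR (ln k.+1%:R) by rewrite lnK.
    rewrite -expRM_natl -expRN -!mulrA -!expRD; congr (_ * expR _); ring.
  apply: ler_pM.
  - by rewrite mulr_ge0 // expR_ge0.
  - by rewrite invr_ge0 exprn_ge0.
  - rewrite ler_wpM2l // ler_expR lerN2 ler_wpM2l //; lra.
  have -> : k%:R^-1 - k.+1%:R^-1 = (k%:R * k.+1%:R)^-1 :> R.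
    by rewrite -natr1; field; rewrite !gt_eqF // natr1.
  rewrite lef_pV2 ?posrE ?mulr_gt0 ?exprn_gt0 // expr2 ler_pM2r // ler_nat //.
have SD n : normc (series u (K + n)%N - series u K) <= D * (K%:R^-1 - (K + n)%:R^-1).
  elim: n => [|n IH]; first by rewrite addn0 !subrr normc0 mulr0.
  have -> : series u (K + n.+1)%N - series u K =
     (series u (K + n)%N - series u K) + u (K + n)%N.
    by rewrite addnS !seriesEnat /= big_nat_recr //=; ring.
  apply: (le_trans (modulusD _ _)); apply: (le_trans (lerD IH (uD _ (leq_addr _ _)))).
  by rewrite -mulrDr addrA subrK addnS.
have SD' n : normc (series u (K + n)%N - series u K) <= D.
  apply: (le_trans (SD n)); rewrite -[leRHS]mulr1 ler_wpM2l //.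
  have : (K%:R : R)^-1 <= 1 by rewrite invf_le1 ?ltr0n // ler1n.
  have : 0 <= ((K + n)%:R : R)^-1 by rewrite invr_ge0.
  lra.
apply/ler_addgt0Pr => e e0.
have hs' : half_plane theta s by rewrite /half_plane /=; move: hs; rewrite /t0 -/t; lra.
have [N HN] := dirichlet_sum_eps (conv _ hs') e0.
have := HN (K + N)%N (leq_addl _ _); rewrite -/u modulusC => H.
have -> : phi s - series u K =
  (phi s - series u (K + N)%N) + (series u (K + N)%N - series u K) by ring.
by apply: (le_trans (modulusD _ _)); have := SD' N; lra.
Qed.

End DirichletSeries.

(** * The characteristic *)

Section Characteristic.
Variable R : realType.
Implicit Types (phi : Cplx R -> Cplx R) (s z : Cplx R).

Lemma nat_cpow1 z : nat_cpow 1 z = 1.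
Proof. by rewrite /nat_cpow ln1 mul0r cexp0. Qed.

Lemma dirichlet_leading (a : nat -> Cplx R) s n : (0 < n)%N ->
  (forall k, (0 < k < n)%N -> a k.+1 = 0) -> series (dirichlet_term a s) n = a 1%N.
Proof.
case: n => // n _; elim: n => [|n IH] a0.
  by rewrite seriesEnat /= big_nat1 /dirichlet_term nat_cpow1 mulr1.
rewrite seriesSr IH.
  by rewrite /dirichlet_term (a0 n.+1) ?ltnSn // mul0r addr0.
by move=> k /andP[k0 kn]; apply: a0; rewrite k0 ltnW.
Qed.

(** The remainder estimate with [K = 1]: far to the right [phi] is close to its constant
    coefficient. *)
Lemma dirichlet_bounded phi : dirichlet_class 0 phi ->
  exists C sigma : R, forall s, sigma <= complex.Re s -> normc (phi s) <= C.
Proof.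
move=> [_ [a [theta [theta0 conv]]]].
have [C [sigma [C0 H]]] := dirichlet_remainder conv (ltnSn 0).
exists (C + normc (a 1%N)), (Order.max 0 sigma) => s; rewrite ge_max => /andP[s0 hs].
have := H _ hs; rewrite dirichlet_leading //; last by case.
move=> L; have := modulusD (phi s - a 1%N) (a 1%N); rewrite subrK => L'.
apply: (le_trans L'); rewrite lerD2r; apply: (le_trans L).
rewrite -[leRHS]mulr1 ler_wpM2l // -[leRHS]expR0 ler_expR oppr_le0.
by rewrite mulr_ge0 // ln_ge0 // ler1n.
Qed.

(* If [phi] were injective, [1 / (phi z - phi s)] would be holomorphic near
   [p = s + 2 pi i / ln N], where [N ^ (- p) = N ^ (- s)]; it is too large at [p]
   for the maximum modulus principle when [Re s] is large. *)
Theorem dirichlet_not_injective phi : dirichlet_class 0 phi ->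
  ~ (forall a b : Cplx R, 0 < complex.Re a -> 0 < complex.Re b ->
       phi a = phi b -> a = b).
Proof.
move=> [dphi [a [theta [theta0 conv]]]] inj.
(* Without a nonzero coefficient beyond the first, [phi] is constant on the half-plane of abscissa
   [theta]. *)
have [ex|none] := pselect (exists k, (0 < k)%N && (a k.+1 != 0)); last first.
  have cst s : theta < complex.Re s -> phi s = a 1%N.
    move=> hs; apply/eqP; rewrite -subr_eq0 -modulus_eq0 eq_le modulus_ge0 andbT.
    apply/ler_addgt0Pr => e e0; rewrite add0r.
    have [N HN] := dirichlet_sum_eps (conv _ hs) e0.
    have := HN N.+1 (leqnSn _); rewrite modulusC dirichlet_leading // => j /andP[j0 _].
    by apply/eqP; apply: contrapT => /negP aj; apply: none; exists j; rewrite j0.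
  have E : phi (theta + 1)%:C = phi (theta + 2)%:C by rewrite !cst //=; lra.
  have := inj _ _ _ _ E; rewrite /= => H.
  by have := congr1 (@complex.Re R) (H _ _) => /=; lra.
(* The integer [N] is [k.+1], the least index above 1 with a nonzero coefficient. *)
have [k /andP[kpos ak] kmin] := ex_minnP ex.
have low j : (0 < j < k.+1)%N -> j != k -> a j.+1 = 0.
  move=> /andP[j0 jk] jnk; apply/eqP; apply: contrapT => /negP aj.
  have := kmin j; rewrite j0 aj => /(_ isT); rewrite leqNgt ltn_neqAle jnk.
  by rewrite -ltnS jk.
have [C [sigma [C0 rem]]] := dirichlet_remainder conv (ltn0Sn k).
pose L : R := ln k.+1%:R; pose L' : R := ln k.+2%:R.
have L0 : 0 < L by rewrite ln_gt0 // ltr1n.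
have LL' : L < L' by rewrite ltr_ln ?posrE ?ltr0n // ltr_nat.
pose A := a k.+1; pose E s := phi s - (a 1%N + A * cexp (- (L%:C * s))).
have EC s : sigma <= complex.Re s -> normc (E s) <= C * expR (- (complex.Re s * L')).
  move=> /rem; rewrite seriesSr.
  rewrite dirichlet_leading //; last first.
    move=> j /andP[j0 jk]; apply: low; first by rewrite j0 ltnW.
    by rewrite neq_ltn jk.
  by rewrite /dirichlet_term /nat_cpow mulrN.
have [c c0 Hc] := cexp_sub1_lower_bound R.
have A0 : 0 < normc A by rewrite modulus_gt0.
(* Multiplication by [L] turns squares of radius [r] into squares of radius 1, to which
   [cexp_sub1_lower_bound] applies. *)
pose r := L^-1; have r0 : 0 < r by rewrite invr_gt0.
have rL : r * L = 1 by rewrite mulVf // gt_eqF.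
pose B := C * (expR (L' * r) + 1).
have B0 : 0 <= B by rewrite mulr_ge0 // addr_ge0 // expR_ge0.
pose dl := L' - L; have dl0 : 0 < dl by rewrite subr_gt0.
(* [E] decays like [(N + 1) ^ (- x)] and the main term like [N ^ (- x)], so the error is negligible
   for large [x]; the witness comes from [1 + y <= expR y]. *)
have [x [xs x0 xB]] : exists x : R, [/\ sigma <= x - r, 0 < x - r &
    B * expR (- (dl * x)) < normc A * c / 2].
  pose T := normc A * c / 2; have T0 : 0 < T by rewrite divr_gt0 // mulr_gt0.
  exists (r + 1 + `|sigma| + B / T / dl); split.
  - have := ler_norm sigma.
    have := divr_ge0 (divr_ge0 B0 (ltW T0)) (ltW dl0).
    lra.
  - have := normr_ge0 sigma.
    have := divr_ge0 (divr_ge0 B0 (ltW T0)) (ltW dl0).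
    lra.
  rewrite expRN ltr_pdivrMr ?expR_gt0 // -/T mulrC -ltr_pdivrMr //.
  apply: lt_le_trans (expR_ge1Dx _).
  rewrite mulrDr [dl * (B / T / dl)]mulrC divfK ?gt_eqF //.
  have : 0 < dl * (r + 1 + `|sigma|) by rewrite mulr_gt0 // ltr_wpDr // addr_gt0.
  lra.
pose s : Cplx R := x%:C; pose p : Cplx R := x +i* (pi *+ 2 * r).
have Rep : complex.Re p = x by [].
have Imp : complex.Im p = pi *+ 2 * r by [].
have Ims : complex.Im s = 0 by [].
pose h z := phi z - phi s.
have hsE z : h z = A * (cexp (- (L%:C * z)) - cexp (- (L%:C * s))) + (E z - E s).
  by rewrite /h /E; ring.
have per (w : Cplx R) : cexp (- (L%:C * (p + w))) = cexp (- (L%:C * s)) * cexp (- (L%:C * w)).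
  have -> : - (L%:C * (p + w)) = (0 +i* (- (pi *+ 2))) + (- (L%:C * s) + - (L%:C * w)).
    have -> : p = s + 0 +i* (pi *+ 2 * r).
      by rewrite /p /s; apply/eqP; rewrite eq_complex /= addr0 add0r !eqxx.
    have <- : - (L%:C * (0 +i* (pi *+ 2 * r))) = 0 +i* (- (pi *+ 2)) :> R[i].
      apply/eqP; rewrite eq_complex /= !mul0r !mulr0 subr0 addr0 oppr0 eqxx /=.
      by rewrite mulrC -mulrA rL mulr1.
    ring.
  by rewrite !cexpD cexp_2pi mul1r.
have ms : normc (cexp (- (L%:C * s))) = expR (- (L * x)).
  by rewrite modulus_cexp /= mulr0 subr0.
have Es z : x - r <= complex.Re z ->
    normc (E z - E s) <= B * expR (- (L' * x)).
  move=> hz; apply: (le_trans (modulusB _ _)).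
  have L'0 : 0 < L' by lra.
  have H1 : normc (E z) <= C * (expR (L' * r) * expR (- (L' * x))).
    apply: (le_trans (EC _ (le_trans xs hz))); rewrite -expRD ler_wpM2l // ler_expR.
    have : L' * (x - r) <= L' * complex.Re z by rewrite ler_pM2l.
    lra.
  have H2 : normc (E s) <= C * expR (- (L' * x)).
    by rewrite (mulrC L'); apply: EC => /=; lra.
  by rewrite /B; lra.
have hp : normc (h p) <= B * expR (- (L' * x)).
  have := per 0; rewrite addr0 mulr0 oppr0 cexp0 mulr1 => cp.
  by rewrite hsE cp subrr mulr0 add0r; apply: Es => /=; lra.
(* Half of the lower bound for the main term on the ring; by [BM] the other half absorbs the
   error. *)
pose M := normc A * c / 2 * expR (- (L * x)).
have M0 : 0 < M by rewrite mulr_gt0 ?expR_gt0 // divr_gt0 // mulr_gt0.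
have BM : B * expR (- (L' * x)) < M.
  have -> : - (L' * x) = - (dl * x) + - (L * x) by rewrite /dl; ring.
  by rewrite expRD mulrA ltr_pM2r ?expR_gt0.
have ring z : r / 2 <= sqnorm (z - p) <= r -> M <= normc (h z).
  move=> /andP[z1 z2]; pose w := z - p.
  have zE : z = p + w by rewrite /w addrC subrK.
  have Lw : sqnorm (- (L%:C * w)) = L * sqnorm w.
    rewrite /sqnorm !(ReN, ImN, ReM, ImM) /= !mul0r subr0 addr0 !normrN !normrM.
    by rewrite gtr0_norm // maxr_pMr // ltW.
  have cw : c <= normc (cexp (- (L%:C * w)) - 1).
    apply: Hc; rewrite Lw; apply/andP; split.
      by rewrite [leLHS](_ : _ = L * (r / 2)) ?ler_pM2l // mulrA (mulrC L) rL.
    by rewrite [leRHS](_ : _ = L * r) ?ler_pM2l // mulrC rL.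
  have Rez : x - r <= complex.Re z.
    move: z2; rewrite ge_max ReD ReN Rep => /andP[+ _]; rewrite ler_norml => /andP[]; lra.
  have main : expR (- (L * x)) * (normc A * c) <=
      normc (A * (cexp (- (L%:C * z)) - cexp (- (L%:C * s)))).
    have -> : A * (cexp (- (L%:C * z)) - cexp (- (L%:C * s))) =
       cexp (- (L%:C * s)) * (A * (cexp (- (L%:C * w)) - 1)).
      by rewrite zE per; ring.
    by rewrite normcM ms normcM ler_pM2l ?expR_gt0 // ler_pM2l.
  have := Es _ Rez => H1.
  have H2 := modulusB (h z) (E z - E s).
  have H3 : normc (h z - (E z - E s)) =
      normc (A * (cexp (- (L%:C * z)) - cexp (- (L%:C * s)))).
    by rewrite hsE addrK.
  move: H2; rewrite H3 => H2; move: main BM; rewrite /M => main BM; lra.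
(* The point [s] is outside the square about [p], since [2 pi r > r]; injectivity then makes [h]
   nonvanishing on the square. *)
have far z : sqnorm (z - p) <= r -> 0 < complex.Re z /\ h z != 0.
  move=> zp; have Rez : 0 < complex.Re z.
    move: zp; rewrite ge_max ReD ReN Rep => /andP[+ _]; rewrite ler_norml => /andP[]; lra.
  split=> //; apply/eqP => /eqP; rewrite subr_eq0 => /eqP E0.
  have zs : z = s by apply: inj => //=; lra.
  move: zp; rewrite zs ge_max ImD ImN Imp Ims => /andP[_].
  have pi2 := @pi_ge2 R.
  have : 4 * r <= pi *+ 2 * r by rewrite ler_pM2r // mulr2n; lra.
  by move=> far; rewrite sub0r normrN ger0_norm; lra.
have : normc ((h p)^-1) <= M^-1.
  apply: (@maximum_modulus R (fun z => (h z)^-1) p (r / 2) r).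
  - by apply/andP; split; lra.
  - move=> z /far [z0 hz]; apply: cdifferentiableV => //.
    apply: cdifferentiableB; last exact: cdifferentiable_cst.
    by apply: derivable_cdifferentiable; exact: dphi.
  - move=> z zr; rewrite normcV; have := ring _ zr => Mz.
    by rewrite lef_pV2 ?posrE // (lt_le_trans M0).
  - by rewrite subrr /sqnorm /= normr0 maxxx; lra.
have [_ hp0] : 0 < complex.Re p /\ h p != 0.
  by apply: far; rewrite subrr /sqnorm /= normr0 maxxx; lra.
rewrite normcV lef_pV2 ?posrE // ?modulus_gt0 // => Mh.
by have := lt_le_trans BM Mh; rewrite ltNge hp.
Qed.

Variable Phi : R -> Cplx R -> Cplx R.
Hypothesis hPhi : continuous_semigroup Phi.

Lemma characteristic_gt0 (t : R) c : 0 <= t -> has_characteristic (Phi t) c -> (0 < c)%N.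
Proof.
move=> t0 [phi [dphi E]]; rewrite lt0n; apply/eqP => c0.
apply: (dirichlet_not_injective dphi) => a b a0 b0 ab.
apply: (semigroup_injective hPhi t0 a0 b0).
by rewrite !E // c0 !mul0r !add0r.
Qed.

(** At a large real [s], both sides of the semigroup law are linear in [s] up to bounded terms.
    Positivity of [d] sends [Phi u s] far to the right, where the Dirichlet part of [Phi t] is
    bounded. *)
Lemma characteristicM (t u : R) (c d e : nat) : 0 <= t -> 0 <= u ->
  has_characteristic (Phi t) c -> has_characteristic (Phi u) d ->
  has_characteristic (Phi (t + u)) e -> e = (c * d)%N.
Proof.
move=> t0 u0 hc hd [phi3 [d3 E3]].
have d_gt0 := characteristic_gt0 u0 hd.
case: hc hd => [phi1 [d1 E1]] [phi2 [d2 E2]].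
have [C1 [s1 B1]] := dirichlet_bounded d1.
have [C2 [s2 B2]] := dirichlet_bounded d2.
have [C3 [s3 B3]] := dirichlet_bounded d3.
have [maps _ Pt _] := hPhi.
have [//|ne] := eqVneq e (c * d)%N; exfalso.
(* Large enough for all three bounds to apply at the points where they are used, and larger than the
   total bounded part [c * C2 + C1 + C3], while [e] and [c * d] would differ by at least 1. *)
pose T := 1 + `|s1| + `|s2| + `|s3| + `|C1| + `|C2| + `|C3| + c%:R * `|C2|.
have T0 : 0 <= c%:R * `|C2| by rewrite mulr_ge0.
pose s : Cplx R := T%:C.
have [n1 n2 n3] : [/\ s1 <= `|s1|, s2 <= `|s2| & s3 <= `|s3|] by rewrite !ler_norm.
have [m1 m2 m3] : [/\ C1 <= `|C1|, C2 <= `|C2| & C3 <= `|C3|] by rewrite !ler_norm.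
have := normr_ge0 s1; have := normr_ge0 s2; have := normr_ge0 s3.
have := normr_ge0 C1; have := normr_ge0 C2; have := normr_ge0 C3.
move=> p1 p2 p3 p4 p5 p6.
have sT : complex.Re s = T by [].
have s0 : half_plane 0 s by rewrite /half_plane /= /T; lra.
have b2 : normc (phi2 s) <= C2 by apply: B2; rewrite sT /T; lra.
have b3 : normc (phi3 s) <= C3 by apply: B3; rewrite sT /T; lra.
have [_ pos] := maps _ u0.
have natRe (n : nat) (z : Cplx R) : complex.Re (n%:R * z) = n%:R * complex.Re z.
  have -> : (n%:R : Cplx R) = (n%:R : R)%:C by rewrite -(rmorph_nat (real_complex R)).
  by rewrite ReM /= mul0r subr0.
have natM (n : nat) : normc (n%:R : Cplx R) = n%:R.
  have -> : (n%:R : Cplx R) = (n%:R : R)%:C by rewrite -(rmorph_nat (real_complex R)).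
  by rewrite modulus_real ger0_norm.
have Rew : s1 <= complex.Re (Phi u s).
  rewrite E2 // ReD natRe sT.
  have : 1 * T <= d%:R * T.
    by rewrite ler_wpM2r ?ler1n // /T; lra.
  have := Re_le_modulus (phi2 s); rewrite ler_norml => /andP[]; rewrite /T; lra.
have b1 := B1 _ Rew.
have main : Phi (t + u) s = Phi t (Phi u s) by rewrite Pt.
rewrite E3 // E1 in main; last exact: pos.
rewrite E2 // in main b1.
have Z : (e%:R - c%:R * d%:R) * s = c%:R * phi2 s + phi1 (d%:R * s + phi2 s) - phi3 s.
  have -> : phi3 s = c%:R * (d%:R * s + phi2 s) + phi1 (d%:R * s + phi2 s) - e%:R * s.
    by rewrite -main; ring.
  ring.
have up : normc ((e%:R - c%:R * d%:R) * s) <= c%:R * C2 + C1 + C3.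
  rewrite Z; apply: (le_trans (modulusB _ _)); apply: lerD => //.
  apply: (le_trans (modulusD _ _)); apply: lerD => //.
  by rewrite normcM natM ler_wpM2l.
have dist : 1 <= normc (e%:R - c%:R * d%:R : Cplx R).
  rewrite -natrM; have [lt|lt|E] := ltngtP e (c * d)%N; last by rewrite E eqxx in ne.
    by rewrite modulusC -natrB ?(ltnW lt) // natM ler1n subn_gt0.
  by rewrite -natrB ?(ltnW lt) // natM ler1n subn_gt0.
have low : T <= normc ((e%:R - c%:R * d%:R) * s).
  rewrite normcM modulus_real ger0_norm; last by rewrite /T; lra.
  by rewrite ler_peMl // /T; lra.
have : c%:R * C2 <= c%:R * `|C2| by rewrite ler_wpM2l.
move: (le_trans low up); rewrite /T; lra.
Qed.

End Characteristic.

Theorem proposition3p2 (R : realType) (Phi : R -> Cplx R -> Cplx R)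
    (c : R -> nat)
    (hPhi : continuous_semigroup Phi)
    (hG : forall t : R, 0 <= t -> class_G_infty (Phi t))
    (hc : forall t : R, 0 <= t -> has_characteristic (Phi t) (c t)) :
  forall t : R, 0 <= t -> c t = 1%N.
Proof.
have c_gt0 t : 0 <= t -> (0 < c t)%N.
  by move=> t0; exact (characteristic_gt0 hPhi t0 (hc t t0)).
have half t : 0 <= t -> c t = (c (t / 2) * c (t / 2))%N.
  move=> t0; have t20 : 0 <= t / 2 by rewrite divr_ge0.
  apply: (characteristicM hPhi t20 t20); [exact: hc..|].
  by rewrite -splitr; exact: hc.
suff H n t : 0 <= t -> (c t <= n)%N -> c t = 1%N by move=> t t0; exact: H (leqnn _).
(* Induction on a bound for [c t], with [t] free so that it can be halved. *)
elim: n t => [|n IH] t t0 ctn; first by have := c_gt0 t t0; lia.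
have t20 : 0 <= t / 2 by rewrite divr_ge0.
(* If [c (t / 2)] does not drop to [n], then [(n + 1) ^ 2 <= c t <= n + 1], which forces [n = 0] and
   [c t = 1]. *)
have [h1|h1] := leqP (c (t / 2)) n; first by rewrite half // IH.
by have := half t t0; have := c_gt0 _ t20; move: ctn h1; nia.
Qed.
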